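(* Let $E=\mathbb C/(\mathbb Z+\tau\mathbb Z)$, let $(K,\vec n)$ be a Wen datum with $K$ primary, and let $\vec\xi\in\mathbb C^g$. Let $\Phi_1,\dots,\Phi_\delta$ be the basis $(\Phi_{\vec c})_{\vec c\in\Pi}$ (enumerated in any order) of the hermitian vector space $\mathsf V_{K,\vec n,\vec\xi}$ of Keski-Vakkuri--Wen wave functions, and let $C=(\langle\Phi_i,\Phi_j\rangle)_{1\le i,j\le\delta}$ be its Gram matrix. Then $C=c\,I_\delta$ for some $c=c(K,\vec n,\vec\xi)\in\mathbb C$.
   Context: Wen datum. $\mathbb N=\{1,2,\dots\}$, $\mathbb N_0=\mathbb N\cup\{0\}$. A Wen matrix is a symmetric positive definite $K\in\mathrm{Mat}_{g\times g}(\mathbb N_0)$ whose diagonal entries are either all even or all odd and such that all entries of $K^{-1}\vec e$ are positive, $\vec e=(1,\dots,1)^t$. A Wen datum is a pair $(K,\vec n)$ with $K$ a Wen matrix and $\vec n=(n_1,\dots,n_g)^t\in\mathbb N^g$ such that $K\vec n=d\vec e$ for some $d\in\mathbb N$. Put $n=\sum n_k$, $\delta=\det K$, $\rho=n\delta/d$ (an integer, equal to the sum of all entries of the adjunct matrix $K^\sharp=\delta K^{-1}$), $\Pi=K^{-1}\mathbb Z^g/\mathbb Z^g$ (a group of order $\delta$). $K$ is primary if $\gcd(\delta,\rho)=1$. $t=\mathrm{Im}\,\tau>0$, $\varphi(z)=\exp(-\pi i\tau-2\pi iz)$. For $k\in\mathbb Z$, $\xi\in\mathbb C$, $\mathcal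 L_{k,\xi}$ is the holomorphic line bundle on $E$ whose sections are the functions $f$ on $\mathbb C$ with $f(z+1)=f(z)$, $f(z+\tau)=\exp(-2\pi i\xi)\varphi(z)^kf(z)$; $\mathcal L^\sharp_{k,\xi}$ is defined by the same rules with an additional factor $-1$ on the right-hand side of both. $X=E^{n_1}\times\dots\times E^{n_g}$ with coordinates $z^{(k)}_p=x^{(k)}_p+\tau y^{(k)}_p$ ($1\le k\le g$, $1\le p\le n_k$; $x,y$ real). For $\vec\xi=\tau\vec a+\vec b$ ($\vec a,\vec b\in\mathbb R^g$), $\mathcal W_{K,\vec n,\vec\xi}$ is the external tensor product over all $(k,p)$ of $\mathcal L_{d,\xi_k}$ if $K_{11}+d$ is even, and of $\mathcal L^\sharp_{d,\xi_k}$ otherwise. $\mathsf W_{K,\vec n,\vec\xi}=\Gamma(X,\mathcal W_{K,\vec n,\vec\xi})$ carries the hermitian scalar product $$\langle\Phi,\Psi\rangle=\int_{[0,1]^{2n}}\Phi\,\overline\Psi\,\prod_{k,p}\exp\bigl(-2\pi dt(y^{(k)}_p)^2-4\pi a_kt\,y^{(k)}_p\bigr)\,dx\,dy.$$ With the divisor $\Xi_K=\sum_kK_{kk}\sum_{p<q}[z^{(k)}_p=z^{(k)}_q]+\sum_{k<l}K_{kl}\sum_{p,q}[z^{(k)}_p=z^{(l)}_q]$, put $\mathsf V_{K,\vec n,\vec\xi}=\Gamma(X,\mathcal W_{K,\vec n,\vec\xi}(-[\Xi_K]))\subset\mathsf W_{K,\vec n,\vec\xi}$ with the restricted scalar product.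 It has dimension $\delta$ with basis, for $\vec c\in\Pi$, $$\Phi_{\vec c}=\Theta[\vec c,\vec 0](K\vec w+\vec\xi\,|\,\tau K)\prod_k\prod_{p<q}\vartheta(z^{(k)}_p-z^{(k)}_q)^{K_{kk}}\prod_{k<l}\prod_{p,q}\vartheta(z^{(k)}_p-z^{(l)}_q)^{K_{kl}},$$ where $\vec w=(w_1,\dots,w_g)^t$, $w_k=\sum_pz^{(k)}_p$, $\Theta[\vec a,\vec b](\vec z|\Omega)=\sum_{\vec k\in\mathbb Z^g}\exp(\pi i(\vec k+\vec a)^t\Omega(\vec k+\vec a)+2\pi i(\vec k+\vec a)^t(\vec z+\vec b))$ and $\vartheta(z)=\sum_{k\in\mathbb Z}\exp(\pi i\tau(k+\frac12)^2+2\pi i(k+\frac12)(z+\frac12))$. *)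

(* Defs.v *)
From HB Require Import structures.
From mathcomp Require Import all_boot all_order all_algebra.
From mathcomp Require Import all_classical all_reals all_analysis.
From mathcomp Require Import complex.
Set Implicit Arguments.
Unset Strict Implicit.
Unset Printing Implicit Defensive.
Import Order.TTheory GRing.Theory Num.Theory.
Import numFieldNormedType.Exports.
Local Open Scope classical_set_scope.
Local Open Scope ring_scope.
Local Open Scope complex_scope.

(** * Wen data *)

Section WenDatum.
Variables (R : realType) (g : nat).

(* [K] as a real matrix. *)
Definition Kreal (K : 'M[nat]_g) : 'M[R]_g := map_mx (fun m : nat => m%:R) K.

Definition posdef (A : 'M[R]_g) : Prop :=
  forall v : 'cV[R]_g, v != 0 -> 0 < (v^T *m A *m v) 0 0.

Definition Wen_matrix (K : 'M[nat]_g) : Prop :=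
  [/\ K^T = K,
      posdef (Kreal K),
      (forall k, ~~ odd (K k k)) \/ (forall k, odd (K k k))
    & forall k, 0 < (invmx (Kreal K) *m (const_mx 1 : 'cV[R]_g)) k 0].

(* The pair (K, n) with the positive integer d such that K n = d e. *)
Definition Wen_datum (K : 'M[nat]_g) (n : 'cV[nat]_g) (d : nat) : Prop :=
  [/\ Wen_matrix K, forall k, (0 < n k ord0)%N, (0 < d)%N & K *m n = const_mx d].

(* det K is an integer, positive for a Wen matrix. *)
Definition delta (K : 'M[nat]_g) : nat := `|\det (map_mx Posz K)|%N.

(* The division is exact for a Wen datum, see [rhoE]. *)
Definition rho (K : 'M[nat]_g) (n : 'cV[nat]_g) (d : nat) : nat :=
  ((\sum_k n k ord0) * delta K %/ d)%N.

Lemma rhoE (K : 'M[nat]_g) (n : 'cV[nat]_g) (d : nat) :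
  Wen_datum K n d -> (rho K n d * d = (\sum_k n k ord0) * delta K)%N.
Proof.
case=> _ _ _ Kn; apply: divnK.
set KZ := map_mx Posz K; pose nZ : 'cV[int]_g := map_mx Posz n.
have KnZ : KZ *m nZ = const_mx d%:Z.
  apply/matrixP => i j; rewrite !mxE.
  have := congr1 (fun A : 'cV[nat]_g => (A i j)%:Z) Kn; rewrite !mxE => <-.
  rewrite -[LHS]/(_ : int) (big_morph Posz PoszD (erefl (0%:Z : int))).
  by apply: eq_bigr => k _; rewrite !mxE PoszM.
have adjE k : \det KZ * (n k ord0)%:Z = (\sum_j \adj KZ k j) * d%:Z.
  have := congr1 (fun A : 'cV[int]_g => A k 0) (mulmxA (\adj KZ) KZ nZ).
  rewrite mul_adj_mx KnZ mul_scalar_mx !mxE => <-.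
  by rewrite mulr_suml; apply: eq_bigr => j _; rewrite !mxE.
have E : (\sum_k n k ord0)%N%:Z * \det KZ =
         (\sum_k \sum_j \adj KZ k j) * d%:Z :> int.
  rewrite (big_morph Posz PoszD (erefl (0%:Z : int))) !mulr_suml.
  by apply: eq_bigr => k _; rewrite mulrC adjE.
have := congr1 absz E; rewrite !abszM !absz_nat -/(delta K) => ->.
exact: dvdn_mull.
Qed.

Definition primary (K : 'M[nat]_g) (n : 'cV[nat]_g) (d : nat) : Prop :=
  gcdn (delta K) (rho K n d) = 1%N.

(* Membership in Z^g and in K^-1 Z^g. *)
Definition in_Zg (c : 'cV[R]_g) : Prop :=
  exists m : 'cV[int]_g, c = map_mx intr m.

Definition in_KinvZg (K : 'M[nat]_g) (c : 'cV[R]_g) : Prop :=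
  exists m : 'cV[int]_g, c = invmx (Kreal K) *m map_mx intr m.

(* [c] lists each class of Pi = K^-1 Z^g / Z^g exactly once, by
   representatives. *)
Definition enumerates_Pi (K : 'M[nat]_g) N (c : 'I_N -> 'cV[R]_g) : Prop :=
  [/\ forall i, in_KinvZg K (c i),
      forall i j, in_Zg (c i - c j) -> i = j
    & forall c', in_KinvZg K c' -> exists i, in_Zg (c' - c i)].

End WenDatum.

(** * Theta functions *)

Section Theta.
Variable R : realType.

Definition expC (z : R[i]) : R[i] :=
  (expR (complex.Re z) * cos (complex.Im z))
  +i* (expR (complex.Re z) * sin (complex.Im z)).

(* The points of the cube [-N, N]^g of Z^g. *)
Definition cube_point g N (f : {ffun 'I_g -> 'I_(N.*2.+1)}) : 'cV[int]_g :=
  \col_k ((f k)%:Z - N%:Z).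

(* Sum over Z^g as the limit of the partial sums over the cubes [-N, N]^g; the
   theta series below converge absolutely, so the exhaustion is immaterial. *)
Definition lattice_sum g (F : 'cV[int]_g -> R[i]) : R[i] :=
  lim ((fun N : nat =>
    (\sum_(f : {ffun 'I_g -> 'I_(N.*2.+1)}) F (cube_point f)) : R[i]^o) @ \oo).

Definition RtoC_mx m n (A : 'M[R]_(m, n)) : 'M[R[i]]_(m, n) :=
  map_mx (fun x : R => x%:C) A.

Definition Theta g (a b : 'cV[R]_g) (z : 'cV[R[i]]_g) (Omega : 'M[R[i]]_g)
    : R[i] :=
  lattice_sum (fun k : 'cV[int]_g =>
    let v := map_mx intr k + RtoC_mx a in
    expC ((pi%:C * 'i) * (v^T *m Omega *m v) 0 0
          + (2 * pi%:C * 'i) * (v^T *m (z + RtoC_mx b)) 0 0)).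

Definition vartheta (tau z : R[i]) : R[i] :=
  lattice_sum (fun k : 'cV[int]_1 =>
    let v := (k 0 0)%:~R + 2^-1 in
    expC (pi%:C * 'i * tau * v ^+ 2 + 2 * pi%:C * 'i * v * (z + 2^-1))).

End Theta.

(** * Integration over [0, 1]^I *)

Section CubeIntegral.
Variable R : realType.

(* Iterated Lebesgue integral over [0, 1] in each of the coordinates listed
   in [s]; the other coordinates are those of [x].  For a continuous integrand,
   the only case used below, this is the integral for the product measure. *)
Fixpoint iter_integral (I : eqType) (s : seq I) (f : (I -> R) -> R)
    (x : I -> R) : R :=
  if s is i :: s' then
    Rintegral (@lebesgue_measure R) `[0, 1]
      (fun u : R => iter_integral s' f (fun j => if j == i then u else x j))
  else f x.

Definition cube_integral (I : finType) (f : (I -> R) -> R) : R :=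
  iter_integral (enum I) f (fun=> 0).

Definition cube_integralC (I : finType) (f : (I -> R) -> R[i]) : R[i] :=
  cube_integral (fun x => complex.Re (f x))
  +i* cube_integral (fun x => complex.Im (f x)).

End CubeIntegral.

(** * Wave functions and their scalar product *)

Section Waves.
Variables (R : realType) (tau : R[i]) (g : nat).
Variables (K : 'M[nat]_g) (n : 'cV[nat]_g) (d : nat) (xi : 'cV[R[i]]_g).

(* Indices (k, p) of the coordinates of E^n_1 x .. x E^n_g; a wave function is
   a function on the universal cover C^(n_1 + .. + n_g). *)
Definition coord : finType := {k : 'I_g & 'I_(n k ord0)}.

Definition zc (z : coord -> R[i]) (k : 'I_g) (p : 'I_(n k ord0)) : R[i] :=
  z (Tagged (fun k => 'I_(n k ord0)) p).

Definition wvec (z : coord -> R[i]) : 'cV[R[i]]_g :=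
  \col_k \sum_(p < n k ord0) zc z p.

Definition wave (c : 'cV[R]_g) (z : coord -> R[i]) : R[i] :=
  let KC := RtoC_mx (Kreal R K) in
  Theta c 0 (KC *m wvec z + xi) (tau *: KC)
  * (\prod_(k < g) \prod_(p < n k ord0) \prod_(q < n k ord0 | (p < q)%N)
       vartheta tau (zc z p - zc z q) ^+ K k k)
  * (\prod_(k < g) \prod_(l < g | (k < l)%N)
       \prod_(p < n k ord0) \prod_(q < n l ord0)
         vartheta tau (zc z p - zc z q) ^+ K k l).

(* The vector a of the decomposition xi = tau a + b into real vectors.
   Taking imaginary parts, a = Im xi / Im tau. *)
Definition xi_a (k : 'I_g) : R := complex.Im (xi k 0) / complex.Im tau.

Definition weight (y : coord -> R) : R :=
  \prod_(kp : coord)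
    expR (- 2 * pi * d%:R * complex.Im tau * y kp ^+ 2
          - 4 * pi * xi_a (tag kp) * complex.Im tau * y kp).

(* The scalar product of the space W of sections, applied to functions on the
   universal cover; the space V spanned by the wave functions carries its
   restriction. *)
Definition scalar_product (Phi Psi : (coord -> R[i]) -> R[i]) : R[i] :=
  cube_integralC (fun x : coord -> R =>
    cube_integralC (fun y : coord -> R =>
      let z := fun kp => (x kp)%:C + tau * (y kp)%:C in
      Phi z * Num.conj (Psi z) * (weight y)%:C)).

Definition Gram N (Phi : 'I_N -> (coord -> R[i]) -> R[i]) : 'M[R[i]]_N :=
  \matrix_(i, j) scalar_product (Phi i) (Phi j).

End Waves.

(* Main.v *)
(** Let e = (1,...,1)^t and u = K^-1 e = n/d.  Translating all coordinates by
    1/d multiplies Phi_c by exp(2 pi i e.c), and translating them by tau/d turns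
    Phi_c into Phi_(c+u) up to an explicit factor whose squared modulus is
    compensated by the weight.  As the integrands are doubly periodic in every
    coordinate, the scalar product is invariant under both translations: thus
    Phi_c and Phi_c' are orthogonal unless e.c = e.c' mod Z, and Phi_c and
    Phi_(c+u) have the same norm.  Since e.u = rho/delta with gcd(delta, rho) = 1,
    the class of u has order delta, so it generates Pi and c |-> e.c is injective
    on Pi. *)
Require Import Defs.
From HB Require Import structures.
From mathcomp Require Import all_boot all_order all_algebra.
From mathcomp Require Import all_classical all_reals all_analysis.
From mathcomp Require Import complex zify ring lra.
Import Order.TTheory GRing.Theory Num.Theory.
Import numFieldNormedType.Exports.
Set Implicit Arguments.
Unset Strict Implicit.
Unset Printing Implicit Defensive.
Local Open Scope classical_set_scope.
Local Open Scope complex_scope.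
Local Open Scope ring_scope.

(** * Uniformly continuous functions and periodic integrals *)

(** A common translation fixes every difference of coordinates, so the product of the [vartheta]
    factors is unchanged and only [Theta] reacts. The fraction 1/d is chosen because the sums w_k
    move by n_k/d and K (n/d) = e. The multiplier of Phi_c under a single period does not depend on
    c; for the period 1 this uses c in K^-1 Z^g, and it is what makes the integrands of two
    different waves periodic. The obstacle is analytic: the scalar product is an iterated integral
    of limits of series. A translation is removed one variable at a time, and each time the inner
    partial integral must again be continuous. Continuity is therefore carried in a quantitative
    form, bounds and moduli on boxes, that survives integration and uniform limits. For the theta
    series the uniformity comes from a geometric majorant supplied by positive definiteness. The
    order of Pi enters through the index type of the enumerations: [delta] pairwise incongruent
    multiples of u must exhaust a list of [delta] classes. *)

Section Box.
Variables (R : realType) (J : eqType).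
Implicit Types (f g : (J -> R) -> R) (x : J -> R).

Definition in_box (B : R) x := forall j, `|x j| <= B.

(** For finite [J] this is plain continuity, made explicit by compactness of boxes. The bound is
    needed for products; the modulus is uniform in all coordinates, so it passes to partial
    integrals. *)
Definition box_uc f := forall B,
  (exists M, forall x, in_box B x -> `|f x| <= M) /\
  (forall e, 0 < e -> exists2 r, 0 < r & forall x y, in_box B x -> in_box B y ->
    (forall j, `|x j - y j| <= r) -> `|f x - f y| <= e).

Lemma box_uc_bound f B : box_uc f ->
  exists2 M, 0 < M & forall x, in_box B x -> `|f x| <= M.
Proof.
move=> /(_ B) [[M hM] _]; exists (Num.max M 1); first by rewrite lt_max ltr01 orbT.
by move=> x /hM h; rewrite le_max h.
Qed.

Lemma box_uc_cst c : box_uc (fun=> c).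
Proof.
move=> B; split; first by exists `|c|.
by move=> e e0; exists 1 => // *; rewrite subrr normr0 ltW.
Qed.

Lemma box_uc_proj j : box_uc (fun x => x j).
Proof.
move=> B; split; first by exists B => x; apply.
by move=> e e0; exists e => // x y _ _; apply.
Qed.

Lemma box_ucD f g : box_uc f -> box_uc g -> box_uc (fun x => f x + g x).
Proof.
move=> uf ug B; split.
  have [M _ hM] := box_uc_bound B uf; have [N _ hN] := box_uc_bound B ug.
  exists (M + N) => x hx; apply: le_trans (ler_normD _ _) _.
  by rewrite lerD ?hM ?hN.
move=> e e0; have e2 : 0 < e / 2 by rewrite divr_gt0.
have [_ /(_ _ e2) [r r0 hr]] := uf B; have [_ /(_ _ e2) [s s0 hs]] := ug B.
exists (Num.min r s); first by rewrite lt_min r0.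
move=> x y hx hy xy.
have -> : f x + g x - (f y + g y) = (f x - f y) + (g x - g y) by ring.
apply: le_trans (ler_normD _ _) _; rewrite [leRHS](splitr e).
by rewrite lerD ?hr ?hs// => j; apply: le_trans (xy j) _; rewrite ge_min lexx ?orbT.
Qed.

Lemma box_ucM f g : box_uc f -> box_uc g -> box_uc (fun x => f x * g x).
Proof.
move=> uf ug B.
have [M M0 hM] := box_uc_bound B uf; have [N N0 hN] := box_uc_bound B ug.
split.
  by exists (M * N) => x hx; rewrite normrM ler_pM ?hM ?hN.
move=> e e0.
have eM : 0 < e / 2 / M by rewrite !divr_gt0.
have eN : 0 < e / 2 / N by rewrite !divr_gt0.
have [_ /(_ _ eN) [r r0 hr]] := uf B; have [_ /(_ _ eM) [s s0 hs]] := ug B.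
exists (Num.min r s); first by rewrite lt_min r0.
move=> x y hx hy xy.
have -> : f x * g x - f y * g y = (f x - f y) * g x + f y * (g x - g y) by ring.
apply: le_trans (ler_normD _ _) _; rewrite [leRHS](splitr e).
have hxy t : Num.min r s <= t -> forall j, `|x j - y j| <= t.
  by move=> ht j; apply: le_trans (xy j) _.
apply: lerD; rewrite normrM.
  rewrite -(divfK (lt0r_neq0 N0) (e / 2)); apply: ler_pM => //; last exact: hN.
  by apply: hr => //; apply: hxy; rewrite ge_min lexx.
rewrite -(divfK (lt0r_neq0 M0) (e / 2)) mulrC; apply: ler_pM => //; last exact: hM.
by apply: hs => //; apply: hxy; rewrite ge_min lexx orbT.
Qed.

Lemma box_ucN f : box_uc f -> box_uc (fun x => - f x).
Proof.
move=> uf; rewrite (_ : (fun _ => _) = (fun x => (-1) * f x)).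
  exact: box_ucM (box_uc_cst _) uf.
by apply/funext => x; rewrite mulN1r.
Qed.

Lemma box_ucB f g : box_uc f -> box_uc g -> box_uc (fun x => f x - g x).
Proof. by move=> uf ug; apply: box_ucD => //; apply: box_ucN. Qed.

(* Each [phi] below satisfies an addition formula, so that its continuity at 0
   is uniform on bounded sets. *)
Lemma box_uc_near0 f (phi : R -> R) : phi @ 0 --> phi 0 -> box_uc f ->
  forall B e, 0 < e -> exists2 r, 0 < r & forall x y, in_box B x -> in_box B y ->
    (forall j, `|x j - y j| <= r) -> `|phi 0 - phi (f x - f y)| < e.
Proof.
move=> /cvgrPdist_lt cphi uf B e e0.
have /nbhs_ballP [s /= s0 hs] := cphi _ e0.
have [_ /(_ (s / 2))] := uf B; rewrite divr_gt0// => /(_ isT) [r r0 hr].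
exists r => // x y hx hy xy; apply: hs; rewrite /ball /= sub0r normrN.
apply: le_lt_trans (hr x y hx hy xy) _; lra.
Qed.

Lemma box_uc_expR f : box_uc f -> box_uc (fun x => expR (f x)).
Proof.
move=> uf B; have [M M0 hM] := box_uc_bound B uf.
have bE x : in_box B x -> `|expR (f x)| <= expR M.
  by move=> /hM h; rewrite ger0_norm ?expR_ge0// ler_expR (le_trans (ler_norm _)).
split; first by exists (expR M).
move=> e e0; have e1 : 0 < e / expR M by rewrite divr_gt0// expR_gt0.
have [r r0 hr] := box_uc_near0 (@continuous_expR R 0) uf B e1.
exists r => // x y hx hy xy.
have -> : expR (f x) - expR (f y) = expR (f y) * (expR (f x - f y) - 1).
  by rewrite expRD expRN mulrBr mulr1 mulrCA mulfV ?gt_eqF ?expR_gt0// mulr1.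
rewrite normrM -(divfK (lt0r_neq0 (expR_gt0 M)) e) mulrC; apply: ler_pM => //.
  by rewrite distrC -(expR0 R) ltW// hr.
exact: bE.
Qed.

Lemma box_uc_cos f : box_uc f -> box_uc (fun x => cos (f x)).
Proof.
move=> uf B; have nc (t : R) : `|cos t| <= 1 by rewrite ler_norml cos_le1 cos_geN1.
have ns (t : R) : `|sin t| <= 1 by rewrite ler_norml sin_le1 sin_geN1.
split; first by exists 1.
move=> e e0; have e1 : 0 < e / 2 by rewrite divr_gt0.
have [r r0 hr] := box_uc_near0 (@continuous_cos R 0) uf B e1.
have [s s0 hs] := box_uc_near0 (@continuous_sin R 0) uf B e1.
exists (Num.min r s); first by rewrite lt_min r0.
move=> x y hx hy xy.
have hxy t : Num.min r s <= t -> forall j, `|x j - y j| <= t.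
  by move=> ht j; apply: le_trans (xy j) _.
have -> : cos (f x) - cos (f y) =
    cos (f y) * (cos (f x - f y) - cos 0) + sin (f y) * (sin 0 - sin (f x - f y)).
  have {1}-> : f x = (f x - f y) + f y by rewrite subrK.
  rewrite cosD cos0 sin0; ring.
apply: le_trans (ler_normD _ _) _; rewrite [leRHS](splitr e) !normrM.
have dl (a b c : R) : `|a| <= 1 -> `|b| < c -> `|a| * `|b| <= c.
  by move=> ha hb; rewrite -[c]mul1r ler_pM// ltW.
apply: lerD; apply: dl => //.
  by rewrite distrC; apply: hr => //; apply: hxy; rewrite ge_min lexx.
by apply: hs => //; apply: hxy; rewrite ge_min lexx orbT.
Qed.

Lemma box_uc_sin f : box_uc f -> box_uc (fun x => sin (f x)).
Proof.
move=> uf; rewrite (_ : (fun _ => _) = (fun x => cos (f x - pi / 2))).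
  by apply: box_uc_cos; apply: box_ucB => //; exact: box_uc_cst.
by apply/funext => x; rewrite -cosBpihalf.
Qed.

(** The three-epsilon argument. It serves to pass from partial sums over cubes to theta series. *)
Lemma box_uc_unif_lim (u : nat -> (J -> R) -> R) f : (forall N, box_uc (u N)) ->
  (forall B e, 0 < e -> exists N, forall x, in_box B x -> `|f x - u N x| <= e) ->
  box_uc f.
Proof.
move=> uu lu B; split.
  have [N hN] := lu B 1 ltr01; have [M _ hM] := box_uc_bound B (uu N).
  exists (1 + M) => x hx; rewrite -(subrK (u N x) (f x)).
  by apply: le_trans (ler_normD _ _) _; rewrite lerD ?hN ?hM.
move=> e e0; have e3 : 0 < e / 3 by rewrite divr_gt0.
have [N hN] := lu B _ e3; have [_ /(_ _ e3) [r r0 hr]] := uu N B.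
exists r => // x y hx hy xy.
have -> : f x - f y = (f x - u N x) + (u N x - u N y) - (f y - u N y) by ring.
apply: le_trans (ler_normB _ _) _.
have := ler_normD (f x - u N x) (u N x - u N y).
have := hN x hx; have := hN y hy; have := hr x y hx hy xy; lra.
Qed.

End Box.

(** * Integrals of continuous functions over the unit interval *)

Section UnitInterval.
Variable R : realType.
Local Notation mu := (@lebesgue_measure R).
Implicit Types f g : R -> R.

Lemma continuous_itv_integrable f a b : continuous f ->
  mu.-integrable `[a, b] (EFin \o f).
Proof.
move=> cf; apply: continuous_compact_integrable; first exact: segment_compact.
exact: continuous_subspaceT.
Qed.

Lemma Rintegral_shift f a b h : a <= b -> continuous f ->
  (\int[mu]_(x in `[a, b]) f (x + h) = \int[mu]_(x in `[(a + h), (b + h)]) f x)%R.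
Proof.
move=> ab cf; rewrite /Rintegral; congr fine; symmetry.
have dF : derive1 (fun x : R => x + h) = cst 1.
  by apply/funext => x; rewrite derive1E deriveD// derive_id derive_cst addr0.
rewrite (@integration_by_substitution_increasing _ (fun x => x + h) f a b)//.
- by apply: eq_integral => x _ /=; rewrite dF fctE /= mulr1.
- by move=> x y _ _; rewrite ltrD2r.
- by rewrite dF => x _; apply: cvg_cst.
- by rewrite dF; exact: is_cvg_cst.
- by rewrite dF; exact: is_cvg_cst.
- have c x : {for x, continuous (fun x : R => x + h)}.
    by apply: cvgD; [exact: cvg_id|exact: cvg_cst].
  split; first by move=> x _; apply: derivableD.
    by apply: cvg_at_right_filter; apply: c.
  by apply: cvg_at_left_filter; apply: c.
- exact: continuous_subspaceT.
Qed.

Lemma Rintegral_split f a b c : a <= b -> b <= c -> continuous f ->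
  (\int[mu]_(x in `[a, c]) f x =
   \int[mu]_(x in `[a, b]) f x + \int[mu]_(x in `[b, c]) f x)%R.
Proof.
move=> ab bc cf.
have := @Rintegral_itvB _ f (BLeft a) (BRight c) b (continuous_itv_integrable a c cf).
rewrite !bnd_simp => /(_ ab bc); rewrite Rintegral_itv_obnd_cbnd.
  by move=> <-; rewrite addrC subrK.
apply: integrableS (@continuous_itv_integrable f b c cf) => //.
by apply: subset_itvr; rewrite bnd_simp.
Qed.

(** The integral becomes one over [h, 1 + h]; it is cut at 1, and the piece [1, 1 + h] is moved back
    by a period to [0, h]. *)
Lemma Rintegral_periodic f h : 0 <= h -> h <= 1 -> continuous f ->
  (forall x, f (x + 1) = f x) ->
  (\int[mu]_(x in `[0, 1]) f (x + h) = \int[mu]_(x in `[0, 1]) f x)%R.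
Proof.
move=> h0 h1 cf pf; rewrite Rintegral_shift// add0r.
rewrite (@Rintegral_split f h 1)//; last by rewrite lerDl.
rewrite (@Rintegral_split f 0 h)// addrC; congr (_ + _).
have := @Rintegral_shift f 0 h 1 h0 cf; rewrite add0r (addrC h) => <-.
by apply: eq_Rintegral => x _; rewrite pf.
Qed.

(** The interval has length 1, so integration does not enlarge a uniform distance; this is why
    moduli of continuity survive it unchanged. *)
Lemma Rintegral_dist f g (e : R) : continuous f -> continuous g ->
  (forall x : R, 0 <= x <= 1 -> `|f x - g x| <= e) ->
  `|\int[mu]_(x in `[0%R, 1%R]) f x - \int[mu]_(x in `[0%R, 1%R]) g x|%R <= e.
Proof.
move=> cf cg fg.
have cfg : continuous (fun x => f x - g x) by move=> x; apply: cvgB; [exact: cf|exact: cg].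
rewrite -RintegralB//; [|exact: continuous_itv_integrable..].
apply: le_trans (le_normr_Rintegral _ _) _ => //; first exact: continuous_itv_integrable.
have cn : continuous (fun x => `|f x - g x|) by move=> x; apply: cvg_norm; apply: cfg.
apply: (@le_trans _ _ (\int[mu]_(x in `[0%R, 1%R]) e)%R); last first.
  by rewrite Rintegral_cst//= lebesgue_measure_itv/= lte_fin ltr01 -EFinD /= subr0 mulr1.
apply: le_Rintegral => //.
- exact: continuous_itv_integrable.
- by apply: (@continuous_itv_integrable (fun=> e)) => x; apply: cvg_cst.
Qed.

End UnitInterval.

(** * Iterated integrals: continuity, linearity, translation *)

Section IterIntegral.
Variables (R : realType) (J : finType).
Local Notation mu := (@lebesgue_measure R).
Implicit Types (f g : (J -> R) -> R) (x h : J -> R) (s : seq J).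

Definition upd x i u : J -> R := fun j => if j == i then u else x j.

Definition periodic_at i f := forall x, f (upd x i (x i + 1)) = f x.

Lemma upd_upd x i u v : upd (upd x i u) i v = upd x i v.
Proof. by apply/funext => j; rewrite /upd; case: eqP. Qed.

Lemma updC x i j u v : i != j -> upd (upd x i u) j v = upd (upd x j v) i u.
Proof.
move=> ij; apply/funext => k; rewrite /upd.
by case: (k =P j) => // ->; rewrite eq_sym (negbTE ij).
Qed.

Lemma upd_val x i u : upd x i u i = u.
Proof. by rewrite /upd eqxx. Qed.

Lemma in_box_upd B x i u : in_box B x -> `|u| <= B -> in_box B (upd x i u).
Proof. by move=> hx hu j; rewrite /upd; case: eqP. Qed.

Lemma in_box_sum x : in_box (\sum_j `|x j|) x.
Proof. by move=> j; rewrite (bigD1 j)//= lerDl sumr_ge0. Qed.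

Lemma in_boxW B C x : B <= C -> in_box B x -> in_box C x.
Proof. by move=> BC hx j; apply: le_trans (hx j) BC. Qed.

Lemma box_uc_continuous f x i : box_uc f -> continuous (fun u => f (upd x i u)).
Proof.
move=> uf u; apply/cvgrPdist_le => e e0.
(* This box contains [x] modified at [i] by [u] or by any [v] within 1 of [u], which explains the
   cap 1 on the radius below. *)
pose B := Num.max (\sum_j `|x j|) (`|u| + 1).
have hx : in_box B x by apply: in_boxW (in_box_sum x); rewrite /B le_max lexx.
have [_ /(_ _ e0) [r r0 hr]] := uf B.
apply/nbhs_ballP; exists (Num.min r 1) => /= [|v]; first by rewrite lt_min r0 ltr01.
rewrite /ball /= => /ltW uv.
have [uv1 uv2] : `|u - v| <= r /\ `|u - v| <= 1.
  by move: uv; rewrite le_min => /andP[].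
apply: hr.
- by apply: in_box_upd => //; rewrite /B le_max lerDl ler01 orbT.
- apply: in_box_upd => //; rewrite /B le_max; apply/orP; right.
  have := ler_normB u (u - v); rewrite opprB addrC subrK; lra.
- by move=> j; rewrite /upd; case: eqP => // _; rewrite subrr normr0 ltW.
Qed.

Lemma itv01_norm_le (B u : R) : 1 <= B -> 0 <= u <= 1 -> `|u| <= B.
Proof. by move=> B1 /andP[u0 u1]; rewrite ger0_norm// (le_trans u1). Qed.

(** The integration variable stays in [0, 1], so the bound and the modulus valid on the box of size
    [max B 1] serve for the integral on the box of size [B]. The bound is the distance to the
    integral of the zero function. *)
Lemma box_uc_iter_integral s f : box_uc f -> box_uc (iter_integral s f).
Proof.
move=> uf; elim: s => [//|i s IH] /=.
set F := iter_integral s f in IH *.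
have cF x : continuous (fun u => F (upd x i u)) by exact: box_uc_continuous.
move=> B; pose C := Num.max B 1.
have C1 : 1 <= C by rewrite /C le_max lexx orbT.
have hC x u : in_box B x -> 0 <= u <= 1 -> in_box C (upd x i u).
  move=> hx hu; apply: in_box_upd; last exact: itv01_norm_le.
  by apply: in_boxW hx; rewrite /C le_max lexx.
split.
  have [M M0 hM] := box_uc_bound C IH; exists M => x hx.
  have := @Rintegral_dist R (fun u => F (upd x i u)) (fun=> 0) M (cF x).
  rewrite (@Rintegral_cst _ _ _ mu)//= mul0r subr0; apply; first by move=> ?; exact: cvg_cst.
  by move=> u hu; rewrite subr0; apply: hM; exact: hC.
move=> e e0; have [_ /(_ _ e0) [r r0 hr]] := IH C; exists r => // x y hx hy xy.
apply: (Rintegral_dist (cF x) (cF y)) => u hu; apply: hr; [exact: hC..|].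
by move=> j; rewrite /upd; case: eqP => // _; rewrite subrr normr0 ltW.
Qed.

(** The shape [a * f + b * g] is that of the real and imaginary parts of a complex multiple, for
    which the lemma is used. Integrability at each stage comes from continuity of the inner
    integral. *)
Lemma iter_integral_lin s f g (a b : R) x : box_uc f -> box_uc g ->
  iter_integral s (fun x => a * f x + b * g x) x =
  a * iter_integral s f x + b * iter_integral s g x.
Proof.
move=> uf ug; elim: s x => [//|i s IH] x /=.
have cf := @box_uc_continuous _ x i (box_uc_iter_integral s uf).
have cg := @box_uc_continuous _ x i (box_uc_iter_integral s ug).
rewrite -!RintegralZl ?continuous_itv_integrable//.
have cM (c : R) (k : R -> R) : continuous k -> continuous (fun u => c * k u).
  by move=> ck u; apply: cvgM; [exact: cvg_cst|exact: ck].
rewrite -RintegralD//; [|apply: continuous_itv_integrable; exact: cM..].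
by apply: eq_Rintegral => u _; rewrite IH.
Qed.

Lemma periodic_iter_integral s f i : periodic_at i f ->
  periodic_at i (iter_integral s f).
Proof.
move=> pf; elim: s => [//|j s IH] x /=; apply: eq_Rintegral => u _.
rewrite -![(fun k => if k == j then _ else _)]/(upd _ j u).
have [->|ij] := eqVneq i j; first by rewrite upd_upd.
by rewrite updC// -[RHS]IH; congr (iter_integral s f (upd _ i (_ + 1))); rewrite /upd (negbTE ij).
Qed.

(** Each integrated coordinate loses its translation, since the inner integral inherits continuity
    and periodicity in that coordinate. Coordinates outside [s] keep it, hence the translated base
    point on the right. *)
Lemma iter_integral_shift s f h x : (forall j, 0 <= h j <= 1) -> box_uc f ->
  (forall i, i \in s -> periodic_at i f) ->
  iter_integral s (fun x => f (fun j => x j + h j)) x =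
  iter_integral s f (fun j => x j + h j).
Proof.
move=> hh uf; elim: s x => [//|i s IH] x pf /=.
pose G u := iter_integral s f (upd (fun j => x j + h j) i u).
transitivity (\int[mu]_(u in `[0%R, 1%R]) G (u + h i))%R.
  apply: eq_Rintegral => u _; rewrite IH; last by move=> j js; apply: pf; rewrite inE js orbT.
  rewrite /G; congr iter_integral; apply/funext => j.
  by rewrite /upd; case: eqP => // ->.
have [h0 h1] := andP (hh i).
rewrite Rintegral_periodic//; first by apply: box_uc_continuous; exact: box_uc_iter_integral.
have pG := @periodic_iter_integral s f i (pf i (mem_head _ _)).
by move=> u; rewrite /G -[RHS]pG upd_upd upd_val.
Qed.

End IterIntegral.

(* A double integral over x and y in [0,1]^I is an iterated integral over
   [0,1]^(I + I). *)
Section DoubleIntegral.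
Variables (R : realType) (I : finType).
Implicit Types (x y : I -> R) (F : (I -> R) -> (I -> R) -> R).

Definition fst_half (w : I + I -> R) : I -> R := fun i => w (inl i).
Definition snd_half (w : I + I -> R) : I -> R := fun i => w (inr i).
Definition glue x y : I + I -> R := fun j => match j with inl i => x i | inr i => y i end.
Definition uncurry_halves F := fun w : I + I -> R => F (fst_half w) (snd_half w).

Definition double_integral F : R :=
  cube_integral (fun x => cube_integral (fun y => F x y)).

Lemma iter_integral_inr s (f : (I + I -> R) -> R) x y :
  iter_integral s (fun y => f (glue x y)) y =
  iter_integral (map inr s) f (glue x y).
Proof.
elim: s y => [//|i s IH] y /=; apply: eq_Rintegral => u _; rewrite IH.
by congr iter_integral; apply/funext => -[].
Qed.

Lemma iter_integral_inl s (f : (I + I -> R) -> R) x y :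
  iter_integral s (fun x => f (glue x y)) x =
  iter_integral (map inl s) f (glue x y).
Proof.
elim: s x => [//|i s IH] x /=; apply: eq_Rintegral => u _; rewrite IH.
by congr iter_integral; apply/funext => -[].
Qed.

Lemma iter_integral_cat (s t : seq (I + I)) (f : (I + I -> R) -> R) w :
  iter_integral (s ++ t) f w = iter_integral s (iter_integral t f) w.
Proof. by elim: s w => [//|i s IH] w /=; apply: eq_Rintegral => u _. Qed.

Lemma double_integralE F : double_integral F =
  iter_integral (map inl (enum I) ++ map inr (enum I)) (uncurry_halves F)
    (fun=> 0).
Proof.
have -> : (fun=> 0) = glue (fun=> 0) (fun=> 0) by apply/funext => -[].
rewrite iter_integral_cat -iter_integral_inl /double_integral /cube_integral.
by congr iter_integral; apply/funext => x; rewrite -iter_integral_inr.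
Qed.

Lemma double_integral_lin F G (a b : R) :
  box_uc (uncurry_halves F) -> box_uc (uncurry_halves G) ->
  double_integral (fun x y => a * F x y + b * G x y) =
  a * double_integral F + b * double_integral G.
Proof. by move=> uF uG; rewrite !double_integralE -iter_integral_lin. Qed.

Lemma double_integral_shift F (a b : R) : 0 <= a <= 1 -> 0 <= b <= 1 ->
  box_uc (uncurry_halves F) ->
  (forall i x y, F (upd x i (x i + 1)) y = F x y) ->
  (forall i x y, F x (upd y i (y i + 1)) = F x y) ->
  double_integral (fun x y => F (fun i => x i + a) (fun i => y i + b)) =
  double_integral F.
Proof.
move=> ha hb uF px py; rewrite !double_integralE.
pose h (j : I + I) := if j is inl _ then a else b.
have := @iter_integral_shift R _ (map inl (enum I) ++ map inr (enum I)) _ h (fun=> 0) _ uF.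
rewrite {1}/uncurry_halves => -> //.
(* The base point is still translated; it is immaterial because [s] lists every coordinate. *)
- set s := _ ++ _.
  suff H w w' : iter_integral s (uncurry_halves F) w = iter_integral s (uncurry_halves F) w' by exact: H.
  have : forall j, j \notin s -> w j = w' j.
    by move=> [i|i]; rewrite mem_cat; [|rewrite orbC]; rewrite map_f ?mem_enum.
  elim: s w w' => [|i s IH] w w' ww' /=.
    by congr uncurry_halves; apply/funext => j; apply: ww'.
  apply: eq_Rintegral => u _; apply: IH => j js.
  by case: eqP => // /eqP ji; apply: ww'; rewrite inE negb_or ji.
- by case.
- move=> [i|i] _ w; rewrite /uncurry_halves.
    rewrite -[RHS](px i); congr (F _ _).
  rewrite -[RHS](py i); congr (F _ _).
Qed.

End DoubleIntegral.

(** * Sums over Z^g *)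

Lemma abszD_le (a b : int) (m n : nat) :
  (absz a <= m -> absz b <= n -> absz (a + b)%R <= m + n)%N.
Proof. lia. Qed.

Lemma abszB_le (a b : int) (m n : nat) :
  (absz a <= m -> absz b <= n -> absz (a - b)%R <= m + n)%N.
Proof. lia. Qed.

Section CubeSum.
Variables (R : realType) (g : nat).
Local Notation Zg := 'cV[int]_g.

Definition cube_seq N : seq Zg :=
  [seq cube_point f | f <- enum {ffun 'I_g -> 'I_(N.*2.+1)}].

Lemma cube_point_inj N : injective (@cube_point g N).
Proof.
move=> f h /matrixP fh; apply/ffunP => k; apply/val_inj.
by have := fh k ord0; rewrite !mxE => /addIr [].
Qed.

Lemma uniq_cube_seq N : uniq (cube_seq N).
Proof. by rewrite map_inj_uniq ?enum_uniq//; exact: cube_point_inj. Qed.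

Lemma mem_cube_seq N (k : Zg) :
  (k \in cube_seq N) = [forall i, (absz (k i ord0) <= N)%N].
Proof.
apply/mapP/forallP => [[f _ ->] i|hk'].
  by rewrite mxE; have := ltn_ord (f i); set m := nat_of_ord _; clearbody m; lia.
have hk i : (absz (k i ord0) <= N)%N by exact: hk'.
pose h i : nat := absz (k i ord0 + N%:Z).
have hE i : (h i)%:Z = k i ord0 + N%:Z by have := hk i; rewrite /h; lia.
have hN i : (h i < N.*2.+1)%N by have := hk i; have := hE i; rewrite -addnn; lia.
exists [ffun i => Ordinal (hN i)]; first by rewrite mem_enum.
by apply/matrixP => i j; rewrite (ord1 j) !mxE ffunE /= hE addrK; congr (k i _); apply/val_inj.
Qed.

Lemma cube_seqP N (k : Zg) :
  reflect (forall i, (absz (k i ord0) <= N)%N) (k \in cube_seq N).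
Proof. by rewrite mem_cube_seq; apply: forallP. Qed.

Lemma cube_seqS N P : (N <= P)%N -> {subset cube_seq N <= cube_seq P}.
Proof. by move=> NP k /cube_seqP hk; apply/cube_seqP => i; exact: leq_trans (hk i) NP. Qed.

Definition cube_sum (F : Zg -> R) N : R := \sum_(k <- cube_seq N) F k.

Lemma cube_sumE (V : nmodType) (F : Zg -> V) N :
  \sum_(f : {ffun 'I_g -> 'I_(N.*2.+1)}) F (cube_point f) =
  \sum_(k <- cube_seq N) F k.
Proof. by rewrite big_map -big_enum. Qed.

Variable r : R.
Hypotheses (r0 : 0 < r) (r1 : r < 1).

(** A majorant whose sum over a cube factors into one-dimensional two-sided geometric sums. *)
Definition geom_weight (k : Zg) : R := \prod_i r ^+ absz (k i ord0).

Local Notation A := (cube_sum geom_weight).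

Lemma geom_weight_ge0 k : 0 <= geom_weight k.
Proof. by apply: prodr_ge0 => i _; rewrite exprn_ge0// ltW. Qed.

Definition dominated M (F : Zg -> R) := forall k, `|F k| <= M * geom_weight k.

(** The terms of [t] outside [s] are majorized by the weights of the cube outside [s]. General lists
    are allowed because a translated cube is not one of the cubes. *)
Lemma sum_subset_dist F M (s t : seq Zg) Q : dominated M F -> uniq s -> uniq t ->
  {subset s <= t} -> {subset t <= cube_seq Q} ->
  `|\sum_(k <- t) F k - \sum_(k <- s) F k| <=
  M * (A Q - \sum_(k <- s) geom_weight k).
Proof.
move=> dF us ut st tQ.
have split_sum (G : Zg -> R) (u v : seq Zg) : uniq u -> uniq v -> {subset u <= v} ->
    \sum_(k <- v) G k - \sum_(k <- u) G k = \sum_(k <- v | k \notin u) G k.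
  move=> uu uv uvS; rewrite (bigID (fun k => k \in u))/=.
  rewrite (_ : \sum_(k <- v | k \in u) G k = \sum_(k <- u) G k); first by rewrite addrAC subrr add0r.
  rewrite -big_filter; apply: perm_big; apply: uniq_perm; rewrite ?filter_uniq//.
  move=> k; rewrite mem_filter; case: (boolP (k \in u)) => //= /uvS ->//.
rewrite split_sum// /cube_sum split_sum ?uniq_cube_seq//; last by move=> k /st /tQ.
rewrite mulr_sumr; apply: le_trans (ler_norm_sum _ _ _) _.
apply: (@le_trans _ _ (\sum_(k <- t | k \notin s) M * geom_weight k)).
  by apply: ler_sum => k _; apply: dF.
rewrite -subr_ge0.
have -> : \sum_(k <- t | k \notin s) M * geom_weight k =
    \sum_(k <- [seq k <- t | k \notin s]) M * geom_weight k by rewrite big_filter.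
have -> : \sum_(k <- cube_seq Q | k \notin s) M * geom_weight k =
    \sum_(k <- [seq k <- cube_seq Q | k \notin s]) M * geom_weight k by rewrite big_filter.
rewrite split_sum ?filter_uniq ?uniq_cube_seq//; last first.
  by move=> k; rewrite !mem_filter => /andP[-> /tQ].
apply: sumr_ge0 => k _; exact: le_trans (normr_ge0 _) (dF k).
Qed.

Lemma cube_sum_dist F M P Q : dominated M F -> (P <= Q)%N ->
  `|cube_sum F Q - cube_sum F P| <= M * (A Q - A P).
Proof. by move=> dF PQ; apply: sum_subset_dist; rewrite ?uniq_cube_seq//; exact: cube_seqS. Qed.

Lemma sum_geom_line N :
  \sum_(j < N.*2.+1) r ^+ absz (j%:Z - N%:Z) <= (1 + r) / (1 - r).
Proof.
have r1' : 0 < 1 - r by rewrite subr_gt0.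
(* The exact value of the two-sided geometric sum: the total minus the two tails beyond N. The
   induction adds one term at each end. *)
suff -> : \sum_(j < N.*2.+1) r ^+ absz (j%:Z - N%:Z) =
    (1 + r) / (1 - r) - 2 * r ^+ N.+1 / (1 - r).
  by rewrite gerBl divr_ge0 ?mulr_ge0 ?exprn_ge0 ?ltW.
elim: N => [|N IH].
  rewrite big_ord1 /= expr0 expr1; field; lra.
rewrite doubleS big_ord_recl big_ord_recr /= /bump /=.
have -> : \sum_(i < N.*2.+1) r ^+ absz (Posz (1 + i) - Posz N.+1) =
    \sum_(j < N.*2.+1) r ^+ absz (j%:Z - N%:Z).
  by apply: eq_bigr => i _; congr (r ^+ absz _); lia.
rewrite IH subn0.
rewrite (_ : absz _ = N.+1); last by lia.
rewrite !exprS; field; lra.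
Qed.

Lemma cube_sum_geom_le N : A N <= ((1 + r) / (1 - r)) ^+ g.
Proof.
rewrite /cube_sum -cube_sumE /geom_weight.
under eq_bigr => f _.
  under eq_bigr => i _ do rewrite mxE.
  over.
rewrite -(bigA_distr_bigA (fun (i : 'I_g) (j : 'I_(N.*2.+1)) => r ^+ absz (j%:Z - N%:Z))).
rewrite -[X in _ ^+ X]card_ord -prodr_const; apply: ler_prod => i _.
by rewrite sum_geom_line sumr_ge0// => j _; rewrite exprn_ge0// ltW.
Qed.

Lemma is_cvg_cube_sum_geom : cvgn A.
Proof.
apply: nondecreasing_is_cvgn.
  move=> P Q PQ; rewrite -subr_ge0.
  have := @cube_sum_dist geom_weight 1 P Q _ PQ; rewrite mul1r => H.
  apply: le_trans (normr_ge0 _) (H _) => k.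
  by rewrite mul1r ger0_norm// geom_weight_ge0.
by exists (((1 + r) / (1 - r)) ^+ g) => _ [N _ <-]; exact: cube_sum_geom_le.
Qed.

(** Adding [M * geom_weight] to the terms makes them nonnegative, so the partial sums increase; they
    stay below twice those of the majorant. The convergent majorant is then subtracted again. *)
Lemma is_cvg_cube_sum F M : dominated M F -> cvgn (cube_sum F).
Proof.
move=> dF; have cMA : cvgn (fun N => M * A N).
  by apply: is_cvgM; [exact: is_cvg_cst|exact: is_cvg_cube_sum_geom].
rewrite (_ : cube_sum F = (fun N => (cube_sum F N + M * A N) - M * A N)); last first.
  by apply/funext => N; rewrite addrK.
apply: is_cvgB => //; apply: nondecreasing_is_cvgn.
  move=> P Q PQ; have := cube_sum_dist dF PQ.
  rewrite ler_norml mulrBr => /andP[h _]; lra.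
have /cvg_seq_bounded [C [_ hC]] := cMA.
exists (2 * (C + 1)) => _ [N _ <-].
have hN : `|M * A N| <= C + 1 by apply: hC => //; rewrite ltrDl.
have : cube_sum F N <= M * A N.
  rewrite /cube_sum mulr_sumr; apply: ler_sum => k _.
  exact: le_trans (ler_norm _) (dF k).
have := ler_norm (M * A N); lra.
Qed.

(** The limit Q -> oo in [cube_sum_dist]. The bound involves [F] only through [M], which gives
    uniform convergence of families with a common majorant. *)
Lemma cube_sum_tail F M N : dominated M F ->
  `|limn (cube_sum F) - cube_sum F N| <= M * (limn A - A N).
Proof.
move=> dF; have cF := is_cvg_cube_sum dF; have cA := is_cvg_cube_sum_geom.
apply: (@ler_cvg_to _ \oo _ _ (fun Q => `|cube_sum F Q - cube_sum F N|)
  (fun Q => M * (A Q - A N))).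
- by apply: cvg_norm; apply: cvgB; [exact: cF|exact: cvg_cst].
- by apply: cvgM; [exact: cvg_cst|apply: cvgB; [exact: cA|exact: cvg_cst]].
- by exists N => // Q /= NQ; apply: cube_sum_dist.
Qed.

Lemma cube_sum_tail0 M e : 0 < e -> exists N, M * (limn A - A N) <= e.
Proof.
move=> e0; have : (fun N => M * (limn A - A N)) @ \oo --> M * (limn A - limn A).
  by apply: cvgM; [exact: cvg_cst|apply: cvgB; [exact: cvg_cst|exact: is_cvg_cube_sum_geom]].
rewrite subrr mulr0 => /cvgrPdist_le /(_ _ e0) [N _ hN]; exists N.
have := hN N (leqnn N); rewrite sub0r normrN; apply: le_trans; exact: ler_norm.
Qed.

(** With mu the sum of the |m_i|, the translate by [m] of the cube of size N + mu contains the cube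
    of size N and lies in that of size N + 2 mu. The two sums thus differ by at most the weight
    between these cubes, which tends to 0. *)
Lemma cvg_cube_sum_translate F M (m : Zg) : dominated M F ->
  cube_sum (fun k => F (k + m)) @ \oo --> limn (cube_sum F).
Proof.
move=> dF; have cF := is_cvg_cube_sum dF; have cA := is_cvg_cube_sum_geom.
pose mu := (\sum_i absz (m i ord0))%N.
have hmu i : (absz (m i ord0) <= mu)%N by rewrite /mu (bigD1 i)//= leq_addr.
rewrite -(cvg_shiftn mu).
rewrite (_ : (fun N => _) = (fun N => cube_sum F N +
    (cube_sum (fun k => F (k + m)) (N + mu)%N - cube_sum F N))); last first.
  by apply/funext => N; rewrite addrC subrK.
rewrite -(addr0 (limn (cube_sum F))); apply: cvgD; first exact: cF.
apply/norm_cvg0P.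
apply: (@squeeze_cvgr _ _ _ _ (fun=> 0) (fun N => M * (A (N + (mu + mu))%N - A N))).
- near=> N; rewrite normr_ge0 /=.
  have -> : cube_sum (fun k => F (k + m)) (N + mu) =
      \sum_(k <- [seq k + m | k <- cube_seq (N + mu)]) F k by rewrite big_map.
  apply: sum_subset_dist => //; rewrite ?uniq_cube_seq//.
  + by rewrite map_inj_uniq ?uniq_cube_seq//; exact: addIr.
  + move=> k /cube_seqP hk; apply/mapP; exists (k - m); last by rewrite subrK.
    apply/cube_seqP => i; rewrite !mxE.
    exact: (abszB_le (hk i) (hmu i)).
  + move=> _ /mapP[k /cube_seqP hk ->]; apply/cube_seqP => i; rewrite mxE.
    by rewrite addnA; exact: (abszD_le (hk i) (hmu i)).
- exact: cvg_cst.
- rewrite -(mulr0 M) -(subrr (limn A)); apply: cvgM; first exact: cvg_cst.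
  by apply: cvgB; [rewrite (cvg_shiftn (mu + mu) A)|]; exact: cA.
Unshelve. all: by end_near. Qed.

End CubeSum.

(** * Complex sums over the lattice *)

Section LatticeSum.
Variables (R : realType) (g : nat).
Implicit Type F : 'cV[int]_g -> R[i].

Lemma Re_sum (I : Type) (s : seq I) (f : I -> R[i]) :
  complex.Re (\sum_(i <- s) f i) = \sum_(i <- s) complex.Re (f i).
Proof. by apply: (big_morph (@complex.Re R)) => [[a b] [c d]|]. Qed.

Lemma Im_sum (I : Type) (s : seq I) (f : I -> R[i]) :
  complex.Im (\sum_(i <- s) f i) = \sum_(i <- s) complex.Im (f i).
Proof. by apply: (big_morph (@complex.Im R)) => [[a b] [c d]|]. Qed.

Lemma lattice_sum_eq F (a b : R) :
  cube_sum (fun k => complex.Re (F k)) @ \oo --> a ->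
  cube_sum (fun k => complex.Im (F k)) @ \oo --> b ->
  lattice_sum F = a +i* b.
Proof.
move=> ca cb; rewrite /lattice_sum; apply: (@cvg_lim (R[i]^o)); first exact: norm_hausdorff.
apply/cvgrPdist_lt => e e0.
(* Positivity in [R[i]] forces [e] to be real, so half of its real part can be allotted to each of
   the two components. *)
have eR : e = (complex.Re e)%:C by case: e e0 => x y; rewrite ltcE /= => /andP[/eqP -> _].
have e2 : 0 < complex.Re e / 2.
  by move: e0; rewrite ltcE /= => /andP[_ h]; rewrite divr_gt0.
move/cvgrPdist_lt : ca => /(_ _ e2) ca; move/cvgrPdist_lt : cb => /(_ _ e2) cb.
near=> N; rewrite cube_sumE.
set S := \sum_(k <- _) F k.
have -> : a +i* b - S = (a - complex.Re S)%:C + 'i%C * (b - complex.Im S)%:C.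
  apply/eqP; rewrite eq_complex; case: (S) => x y /=.
  by rewrite !(mul0r, mul1r, subr0, addr0, add0r, mulr0) !eqxx.
apply: le_lt_trans (ler_normD _ _) _.
rewrite normrM; have -> : `|'i%C| = 1 :> R[i].
  by rewrite normc_def /= expr0n /= expr1n add0r sqrtr1.
rewrite mul1r !normc_def /= expr0n /= !addr0 !sqrtr_sqr.
rewrite eR -rmorphD ltcR /S Re_sum Im_sum.
have : `|a - cube_sum (fun k => complex.Re (F k)) N| < complex.Re e / 2 by near: N.
have : `|b - cube_sum (fun k => complex.Im (F k)) N| < complex.Re e / 2 by near: N.
rewrite /cube_sum; lra.
Unshelve. all: by end_near. Qed.

Variable r : R.
Hypotheses (r0 : 0 < r) (r1 : r < 1).

Definition cdominated M F :=
  dominated r M (fun k => complex.Re (F k)) /\ dominated r M (fun k => complex.Im (F k)).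

Lemma lattice_sum_lim F M : cdominated M F -> lattice_sum F =
  limn (cube_sum (fun k => complex.Re (F k))) +i* limn (cube_sum (fun k => complex.Im (F k))).
Proof.
by move=> [dR dI]; apply: lattice_sum_eq; [exact: is_cvg_cube_sum dR|exact: is_cvg_cube_sum dI].
Qed.

Lemma lattice_sum_translate F M m : cdominated M F ->
  lattice_sum (fun k => F (k + m)) = lattice_sum F.
Proof.
move=> dF; rewrite (lattice_sum_lim dF); have [dR dI] := dF.
apply: lattice_sum_eq.
  exact: (cvg_cube_sum_translate r0 r1 (F := fun k => complex.Re (F k)) m dR).
exact: (cvg_cube_sum_translate r0 r1 (F := fun k => complex.Im (F k)) m dI).
Qed.

Lemma lattice_sumZ F M (c : R[i]) : cdominated M F ->
  lattice_sum (fun k => c * F k) = c * lattice_sum F.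
Proof.
move=> dF; rewrite (lattice_sum_lim dF); have [dR dI] := dF.
have cR := is_cvg_cube_sum r0 r1 dR; have cI := is_cvg_cube_sum r0 r1 dI.
case: c => a b; apply: lattice_sum_eq.
  rewrite (_ : cube_sum _ = (fun N => a * cube_sum (fun k => complex.Re (F k)) N
      - b * cube_sum (fun k => complex.Im (F k)) N)); last first.
    apply/funext => N; rewrite /cube_sum !mulr_sumr -sumrB.
    by apply: eq_bigr => k _; case: (F k).
  by apply: cvgB; apply: cvgM => //; exact: cvg_cst.
rewrite (_ : cube_sum _ = (fun N => a * cube_sum (fun k => complex.Im (F k)) N
    + b * cube_sum (fun k => complex.Re (F k)) N)); last first.
  apply/funext => N; rewrite /cube_sum !mulr_sumr -big_split /=.
  by apply: eq_bigr => k _; case: (F k).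
by apply: cvgD; apply: cvgM => //; exact: cvg_cst.
Qed.

End LatticeSum.

(** * The complex exponential *)

Section ExpC.
Variable R : realType.
Implicit Types (z w : R[i]) (x y : R).

Lemma reCD z w : complex.Re (z + w) = complex.Re z + complex.Re w.
Proof. by case: z w => [a b] [c d]. Qed.
Lemma imCD z w : complex.Im (z + w) = complex.Im z + complex.Im w.
Proof. by case: z w => [a b] [c d]. Qed.
Lemma reCM z w : complex.Re (z * w) = complex.Re z * complex.Re w - complex.Im z * complex.Im w.
Proof. by case: z w => [a b] [c d]. Qed.
Lemma imCM z w : complex.Im (z * w) = complex.Re z * complex.Im w + complex.Im z * complex.Re w.
Proof. by case: z w => [a b] [c d]. Qed.
Lemma reCN z : complex.Re (- z) = - complex.Re z.
Proof. by case: z. Qed.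
Lemma imCN z : complex.Im (- z) = - complex.Im z.
Proof. by case: z. Qed.

Definition ReImE := (reCD, imCD, reCM, imCM, reCN, imCN).

Lemma complexP z w : complex.Re z = complex.Re w -> complex.Im z = complex.Im w -> z = w.
Proof. by case: z w => [a b] [c d] /= -> ->. Qed.

Lemma RtoC_nat n : n%:R = n%:R%:C :> R[i].
Proof. by rewrite rmorph_nat. Qed.

Lemma expCD z w : expC (z + w) = expC z * expC w.
Proof.
apply: complexP; rewrite ?ReImE /= !ReImE expRD (cosD, sinD); ring.
Qed.

Lemma expC0 : expC (0 : R[i]) = 1.
Proof. by apply: complexP; rewrite /= expR0 ?cos0 ?sin0 ?mulr1 ?mulr0. Qed.

Lemma expC_sum (I : Type) (s : seq I) (P : pred I) (f : I -> R[i]) :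
  expC (\sum_(i <- s | P i) f i) = \prod_(i <- s | P i) expC (f i).
Proof. exact: (big_morph _ expCD expC0). Qed.

Lemma expC_mulrn z n : expC (z *+ n) = expC z ^+ n.
Proof. by elim: n => [|n IH]; rewrite ?expC0// mulrS exprS expCD IH. Qed.

Lemma conjE z : Num.conj z = complex.Re z -i* complex.Im z.
Proof. by case: z. Qed.

Lemma expC_mul_conj z : expC z * Num.conj (expC z) = (expR (2 * complex.Re z))%:C.
Proof.
have e2 : expR (2 * complex.Re z) = expR (complex.Re z) ^+ 2 by rewrite expr2 -expRD; congr expR; ring.
rewrite conjE; apply: complexP; rewrite !ReImE /= ?e2; last by ring.
by rewrite -[RHS]mulr1 -(cos2Dsin2 (complex.Im z)); ring.
Qed.

Lemma Re_i : complex.Re ('i : R[i]) = 0.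
Proof. by rewrite -complexiE. Qed.

Lemma Im_i : complex.Im ('i : R[i]) = 1.
Proof. by rewrite -complexiE. Qed.

Lemma Re_nat n : complex.Re (n%:R : R[i]) = n%:R.
Proof. by rewrite RtoC_nat. Qed.

Lemma Im_nat n : complex.Im (n%:R : R[i]) = 0.
Proof. by rewrite RtoC_nat. Qed.

Lemma Re_real x : complex.Re x%:C = x.
Proof. by []. Qed.

Lemma Im_real x : complex.Im x%:C = 0.
Proof. by []. Qed.

Lemma Re_pi_i z : complex.Re (pi%:C * 'i * z) = - (pi * complex.Im z).
Proof. by rewrite !(reCM, imCM) Re_real Im_real Re_i Im_i; ring. Qed.

Lemma Im_pi_i z : complex.Im (pi%:C * 'i * z) = pi * complex.Re z.
Proof. by rewrite !(reCM, imCM) Re_real Im_real Re_i Im_i; ring. Qed.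

Lemma Re_2pi_i z : complex.Re (2 * pi%:C * 'i * z) = - (2 * pi * complex.Im z).
Proof. by rewrite !(reCM, imCM) Re_nat Im_nat Re_real Im_real Re_i Im_i; ring. Qed.

Lemma Im_2pi_i z : complex.Im (2 * pi%:C * 'i * z) = 2 * pi * complex.Re z.
Proof. by rewrite !(reCM, imCM) Re_nat Im_nat Re_real Im_real Re_i Im_i; ring. Qed.

Definition unit_exp x : R[i] := expC (2 * pi%:C * 'i * x%:C).

Lemma unit_expE x : unit_exp x = cos (2 * pi * x) +i* sin (2 * pi * x).
Proof.
by rewrite /unit_exp /expC Re_2pi_i Im_2pi_i Re_real Im_real mulr0 oppr0 expR0 !mul1r.
Qed.

Lemma unit_expD x y : unit_exp (x + y) = unit_exp x * unit_exp y.
Proof. by rewrite /unit_exp -expCD -mulrDr -rmorphD. Qed.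

Lemma conj_unit_exp x : Num.conj (unit_exp x) = unit_exp (- x).
Proof. by rewrite conjE !unit_expE /= mulrN cosN sinN. Qed.

Lemma unit_exp_nat (m : nat) : unit_exp m%:R = 1.
Proof.
elim: m => [|m IH]; first by rewrite /unit_exp mulr0 expC0.
rewrite -natr1 unit_expD IH mul1r unit_expE mulr1 mulr_natl cos2pi sin2pi.
exact: complexP.
Qed.

Lemma unit_exp_int (m : int) : unit_exp m%:~R = 1.
Proof.
case: m => m; first exact: unit_exp_nat.
have := unit_expD m.+1%:R (Negz m)%:~R; rewrite NegzE mulrNz subrr unit_exp_nat mul1r => <-.
exact: (unit_exp_nat 0).
Qed.

(** For the fractional part y, cos (2 pi y) = 1 gives sin (pi y) = 0 by the duplication formula,
    whereas the sine is positive on the open interval from 0 to pi. *)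
Lemma unit_exp_eq1 x : unit_exp x = 1 -> exists m : int, x = m%:~R.
Proof.
move=> x1; exists (Num.floor x); pose y := x - (Num.floor x)%:~R.
have y0 : 0 <= y by rewrite subr_ge0 floor_le.
have y1 : y < 1 by rewrite ltrBlDl; have := floorD1_gt x; rewrite intrD.
have : unit_exp y = 1.
  have := unit_expD y (Num.floor x)%:~R; rewrite unit_exp_int mulr1 => <-.
  by rewrite subrK.
rewrite unit_expE => /(congr1 (@complex.Re R)) /=.
rewrite -mulrA mulr_natl cos_mulr2n => c1.
have [y00|y00] := eqVneq y 0; first by apply/eqP; rewrite -subr_eq0 -/y y00.
have : 0 < sin (pi * y).
  apply: sin_gt0_pi; apply/andP; split; last by rewrite gtr_pMr ?pi_gt0.
  by rewrite mulr_gt0 ?pi_gt0// lt_neqAle eq_sym y00.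
have : sin (pi * y) ^+ 2 = 0 by rewrite sin2cos2; lra.
by move/eqP; rewrite sqrf_eq0 => /eqP ->; rewrite ltxx.
Qed.

Lemma expC_pi_i : expC (pi%:C * 'i) = -1 :> R[i].
Proof.
rewrite -[X in expC X]mulr1 /expC Re_pi_i Im_pi_i /= mulr0 oppr0 expR0 mulr1 cospi sinpi !mul1r.
by apply: complexP; rewrite /= ?oppr0.
Qed.

Lemma expC_2pi_i : expC (2 * pi%:C * 'i) = 1 :> R[i].
Proof. by have := unit_exp_nat 1; rewrite /unit_exp rmorph_nat mulr1. Qed.

End ExpC.

(** * Uniform continuity on boxes for complex-valued functions *)

Section ComplexBox.
Variables (R : realType) (J : finType).
Implicit Types (f h : (J -> R) -> R[i]).

Definition cbox_uc f :=
  box_uc (fun x => complex.Re (f x)) /\ box_uc (fun x => complex.Im (f x)).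

Lemma cbox_uc_cst c : cbox_uc (fun=> c).
Proof. by split; exact: box_uc_cst. Qed.

Lemma cbox_uc_proj j : cbox_uc (fun x => (x j)%:C).
Proof. by split; [exact: box_uc_proj|exact: box_uc_cst]. Qed.

Lemma eq_cbox_uc f h : cbox_uc f -> f =1 h -> cbox_uc h.
Proof. by move=> uf /funext <-. Qed.

Lemma cbox_ucD f h : cbox_uc f -> cbox_uc h -> cbox_uc (fun x => f x + h x).
Proof.
by move=> [fR fI] [hR hI]; split; under eq_fun do rewrite ReImE; exact: box_ucD.
Qed.

Lemma cbox_ucM f h : cbox_uc f -> cbox_uc h -> cbox_uc (fun x => f x * h x).
Proof.
move=> [fR fI] [hR hI]; split; under eq_fun do rewrite !ReImE.
  by apply: box_ucB; exact: box_ucM.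
by apply: box_ucD; exact: box_ucM.
Qed.

Lemma cbox_ucN f : cbox_uc f -> cbox_uc (fun x => - f x).
Proof. by move=> [fR fI]; split; under eq_fun do rewrite ReImE; exact: box_ucN. Qed.

Lemma cbox_ucB f h : cbox_uc f -> cbox_uc h -> cbox_uc (fun x => f x - h x).
Proof. by move=> uf uh; apply: cbox_ucD => //; exact: cbox_ucN. Qed.

Lemma cbox_uc_conj f : cbox_uc f -> cbox_uc (fun x => Num.conj (f x)).
Proof.
move=> [fR fI]; split; under eq_fun do rewrite conjE /=; first exact: fR.
exact: box_ucN.
Qed.

Lemma cbox_uc_sum (I : Type) (s : seq I) (P : pred I) (F : I -> (J -> R) -> R[i]) :
  (forall i, P i -> cbox_uc (F i)) -> cbox_uc (fun x => \sum_(i <- s | P i) F i x).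
Proof.
move=> uF; elim: s => [|i s IH].
  by apply: eq_cbox_uc (cbox_uc_cst 0) _ => x; rewrite big_nil.
have [Pi|nPi] := boolP (P i); last first.
  by apply: eq_cbox_uc IH _ => x; rewrite big_cons (negbTE nPi).
by apply: eq_cbox_uc (cbox_ucD (uF i Pi) IH) _ => x; rewrite big_cons Pi.
Qed.

Lemma cbox_uc_prod (I : Type) (s : seq I) (P : pred I) (F : I -> (J -> R) -> R[i]) :
  (forall i, P i -> cbox_uc (F i)) -> cbox_uc (fun x => \prod_(i <- s | P i) F i x).
Proof.
move=> uF; elim: s => [|i s IH].
  by apply: eq_cbox_uc (cbox_uc_cst 1) _ => x; rewrite big_nil.
have [Pi|nPi] := boolP (P i); last first.
  by apply: eq_cbox_uc IH _ => x; rewrite big_cons (negbTE nPi).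
by apply: eq_cbox_uc (cbox_ucM (uF i Pi) IH) _ => x; rewrite big_cons Pi.
Qed.

Lemma cbox_ucX f n : cbox_uc f -> cbox_uc (fun x => f x ^+ n).
Proof.
move=> uf; elim: n => [|n IH]; first exact: cbox_uc_cst.
by apply: eq_cbox_uc (cbox_ucM uf IH) _ => x; rewrite exprS.
Qed.

Lemma cbox_uc_expC f : cbox_uc f -> cbox_uc (fun x => expC (f x)).
Proof.
move=> [fR fI]; split; apply: box_ucM; do ?exact: box_uc_expR.
  exact: box_uc_cos.
exact: box_uc_sin.
Qed.

End ComplexBox.

(** * Theta functions of a positive definite form *)

Section QuadraticForm.
Variables (R : realType) (g : nat) (A : 'M[R]_g).
Hypotheses (Asym : A^T = A) (Apos : posdef A).
Implicit Types u v w : 'cV[R]_g.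

Definition dotr u v : R := (u^T *m v) ord0 ord0.

Lemma dotrE u v : dotr u v = \sum_i u i ord0 * v i ord0.
Proof. by rewrite /dotr mxE; apply: eq_bigr => i _; rewrite mxE. Qed.

Lemma dotrC u v : dotr u v = dotr v u.
Proof. by rewrite !dotrE; apply: eq_bigr => i _; rewrite mulrC. Qed.

Lemma dotrDl u v w : dotr (u + v) w = dotr u w + dotr v w.
Proof. by rewrite /dotr linearD mulmxDl mxE. Qed.

Lemma dotrDr u v w : dotr u (v + w) = dotr u v + dotr u w.
Proof. by rewrite /dotr mulmxDr mxE. Qed.

Lemma dotrZl (a : R) u v : dotr (a *: u) v = a * dotr u v.
Proof. by rewrite /dotr linearZ -scalemxAl mxE. Qed.

Lemma dotrZr (a : R) u v : dotr u (a *: v) = a * dotr u v.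
Proof. by rewrite /dotr -scalemxAr mxE. Qed.

Lemma dotr_mulmx u v : dotr u (A *m v) = dotr (A *m u) v.
Proof. by rewrite /dotr trmx_mul Asym mulmxA. Qed.

Definition quad v : R := dotr v (A *m v).

Lemma quadD u v : quad (u + v) = quad u + quad v + 2 * dotr u (A *m v).
Proof.
rewrite /quad mulmxDr !(dotrDl, dotrDr) (dotrC v (A *m u)) -dotr_mulmx; ring.
Qed.

Lemma quad_ge0 v : 0 <= quad v.
Proof.
have [->|v0] := eqVneq v 0; first by rewrite /quad /dotr mulmx0 mulmx0 mxE.
by rewrite /quad /dotr mulmxA ltW// Apos.
Qed.

Lemma posdef_unitmx : A \in unitmx.
Proof.
rewrite -row_free_unit -kermx_eq0; apply/negPn/negP => /rowV0Pn[v /sub_kermxP vA v0].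
have := Apos (v := v^T); rewrite trmx_eq0 => /(_ v0).
by rewrite trmxK vA mul0mx mxE ltxx.
Qed.

(* Cauchy-Schwarz for the form [A] applied to [v] and to column [i] of [A^-1]. *)
Lemma sqr_coord_le_quad v i : v i ord0 ^+ 2 <= invmx A i i * quad v.
Proof.
pose w : 'cV[R]_g := col i (invmx A).
have Aw : A *m w = delta_mx i ord0.
  by rewrite /w colE mulmxA mulmxV ?posdef_unitmx// mul1mx.
have dotd u : dotr u (delta_mx i ord0) = u i ord0.
  rewrite dotrE (bigD1 i)//= mxE !eqxx mulr1 big1 ?addr0// => k ki.
  by rewrite mxE (negbTE ki) mulr0.
have qw : quad w = invmx A i i by rewrite /quad Aw dotd mxE.
have w0 : w != 0.
  apply: contra_eq_neq (Aw) => ->; rewrite mulmx0; apply/eqP => /matrixP /(_ i ord0).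
  by rewrite !mxE !eqxx => /eqP; rewrite eq_sym oner_eq0.
have a0 : 0 < invmx A i i by rewrite -qw /quad /dotr mulmxA Apos.
set a := invmx A i i in qw a0 *.
have := quad_ge0 (v + (- (v i ord0 / a)) *: w).
rewrite quadD -scalemxAr dotrZr Aw dotd /quad -scalemxAr dotrZl dotrZr -/(quad w) qw -/(quad v).
set q := quad v; set s := v i ord0.
have -> : q + - (s / a) * (- (s / a) * a) + 2 * (- (s / a) * s) = q - s ^+ 2 / a.
  by field; rewrite lt0r_neq0.
by rewrite subr_ge0 ler_pdivrMr// mulrC.
Qed.

Lemma posdef_coercive : exists2 e : R, 0 < e & forall v, e * \sum_i v i ord0 ^+ 2 <= quad v.
Proof.
pose T := \sum_i `|invmx A i i|.
have T0 : 0 <= T by apply: sumr_ge0.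
(* Summing [sqr_coord_le_quad] over the coordinates gives the constant [T]; adding 1 keeps it
   invertible, also for [g = 0]. *)
exists (T + 1)^-1 => [|v]; first by rewrite invr_gt0; lra.
rewrite ler_pdivrMl; last lra.
apply: (@le_trans _ _ (T * quad v)); last by rewrite ler_wpM2r ?quad_ge0//; lra.
rewrite mulr_suml; apply: ler_sum => i _; apply: le_trans (sqr_coord_le_quad v i) _.
by rewrite ler_wpM2r ?quad_ge0// ler_norm.
Qed.

End QuadraticForm.

(** * Theta series with period matrix [tau] times a real form *)

Section ThetaFunction.
Variables (R : realType) (tau : R[i]) (htau : 0 < complex.Im tau).
Variables (g : nat) (A : 'M[R]_g).
Hypotheses (Asym : A^T = A) (Apos : posdef A).
Implicit Types (v u c : 'cV[R]_g) (z : 'cV[R[i]]_g) (k m : 'cV[int]_g).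

Definition dotc v z : R[i] := \sum_i (v i ord0)%:C * z i ord0.

Lemma dotcDl u v z : dotc (u + v) z = dotc u z + dotc v z.
Proof. by rewrite -big_split; apply: eq_bigr => i _; rewrite mxE rmorphD mulrDl. Qed.

Lemma dotcDr v z w : dotc v (z + w) = dotc v z + dotc v w.
Proof. by rewrite -big_split; apply: eq_bigr => i _; rewrite mxE mulrDr. Qed.

Lemma dotcZr v (a : R[i]) z : dotc v (a *: z) = a * dotc v z.
Proof. by rewrite mulr_sumr; apply: eq_bigr => i _; rewrite mxE mulrCA. Qed.

Lemma dotc_real v u : dotc v (RtoC_mx u) = (dotr v u)%:C.
Proof.
by rewrite dotrE rmorph_sum; apply: eq_bigr => i _; rewrite mxE -rmorphM.
Qed.

Definition theta_exponent v z : R[i] :=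
  pi%:C * 'i * (tau * (quad A v)%:C) + 2 * pi%:C * 'i * dotc v z.

Definition theta_term c z k : R[i] := expC (theta_exponent (map_mx intr k + c) z).

Definition theta c z : R[i] := lattice_sum (theta_term c z).

Lemma ThetaE c b z : Theta c b z (tau *: RtoC_mx A) = theta c (z + RtoC_mx b).
Proof.
rewrite /Theta /theta; congr lattice_sum; apply/funext => k; rewrite /theta_term.
set v := map_mx intr k + c.
have -> : map_mx intr k + RtoC_mx c = RtoC_mx v.
  by apply/matrixP => i j; rewrite !mxE rmorphD rmorph_int.
congr expC; congr (_ * _ + _ * _).
  rewrite -scalemxAr -scalemxAl mxE; congr (_ * _).
  have <- : dotc v (RtoC_mx (A *m v)) = (quad A v)%:C by rewrite dotc_real.
  rewrite -mulmxA mxE; apply: eq_bigr => i _; rewrite !mxE; congr (_ * _).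
  rewrite rmorph_sum; apply: eq_bigr => j _; by rewrite !mxE -rmorphM.
by rewrite mxE; apply: eq_bigr => i _; rewrite !mxE.
Qed.

Lemma Re_theta_exponent v z : complex.Re (theta_exponent v z) =
  - (pi * complex.Im tau * quad A v) - 2 * pi * \sum_i v i ord0 * complex.Im (z i ord0).
Proof.
rewrite /theta_exponent reCD Re_pi_i Re_2pi_i imCM Re_real Im_real /dotc Im_sum.
rewrite (eq_bigr (fun i => v i ord0 * complex.Im (z i ord0))); first by ring.
by move=> i _; rewrite imCM Re_real Im_real; ring.
Qed.

Local Notation r := (expR (- 1 : R)).

Lemma ratio_gt0 : 0 < r. Proof. exact: expR_gt0. Qed.
Lemma ratio_lt1 : r < 1. Proof. by rewrite expR_lt1; lra. Qed.

(** The Gaussian decay given by coercivity beats the linear growth caused by [z]. [M] depends on [z]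
    only through the bound [B] on imaginary parts, so the majorant is uniform on strips. *)
Lemma theta_term_dominated c B : exists M, forall z,
  (forall i, `|complex.Im (z i ord0)| <= B) -> cdominated r M (theta_term c z).
Proof.
have [e e0 he] := posdef_coercive Asym Apos.
(* [al] is the Gaussian rate per coordinate. In [be], 2 pi B is the linear growth due to [z], and
   the extra 1 leaves room for the factor exp (-|k_i|), the weight for the ratio exp (-1). *)
pose al := pi * complex.Im tau * e; pose be := 2 * pi * B + 1.
have al0 : 0 < al by rewrite !mulr_gt0 ?pi_gt0.
(* The maximum of be s - al s^2 is be^2 / (4 al); the term |c_i| pays for replacing v = k + c by
   k. *)
pose C := \sum_(i < g) (be ^+ 2 / (4 * al) + `|c i ord0|).
exists (expR C) => z hz.
suff H k : expR (complex.Re (theta_exponent (map_mx intr k + c) z)) <=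
    expR C * geom_weight r k.
  split=> k; apply: le_trans (H k); rewrite /theta_term /expC /= normrM ger0_norm ?expR_ge0//;
    by rewrite ler_piMr ?expR_ge0// ?cos_max ?sin_max.
have -> : geom_weight r k = expR (\sum_i (- `|(k i ord0)%:~R|)).
  rewrite expR_sum; apply: eq_bigr => i _.
  by rewrite -expRM_natl mulrN1 natr_absz intr_norm.
rewrite -expRD ler_expR -big_split Re_theta_exponent /=.
set v := map_mx intr k + c.
apply: (@le_trans _ _ (\sum_i (- (al * v i ord0 ^+ 2) + 2 * pi * (`|v i ord0| * B)))).
  rewrite big_split /= sumrN -!mulr_sumr; apply: lerD.
    rewrite lerN2 /al -mulrA; apply: ler_wpM2l; last exact: he.
    by rewrite mulr_ge0 ?pi_ge0// ltW.
  rewrite -mulrN ler_wpM2l ?mulr_ge0 ?pi_ge0// -sumrN; apply: ler_sum => i _.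
  apply: le_trans (ler_norm _) _; rewrite normrN normrM ler_wpM2l//.
apply: ler_sum => i _.
have kv : `|(k i ord0)%:~R| <= `|v i ord0| + `|c i ord0|.
  by rewrite (_ : (k i ord0)%:~R = v i ord0 - c i ord0) ?ler_normB// !mxE addrK.
have -> : v i ord0 ^+ 2 = `|v i ord0| ^+ 2 by rewrite real_normK ?num_real.
set s := `|v i ord0| in kv *.
have : be * s <= be ^+ 2 / (4 * al) + al * s ^+ 2.
  rewrite -subr_ge0.
  have -> : be ^+ 2 / (4 * al) + al * s ^+ 2 - be * s = (2 * al * s - be) ^+ 2 / (4 * al).
    by field; rewrite lt0r_neq0.
  by rewrite divr_ge0 ?sqr_ge0// mulr_ge0// ltW.
rewrite /be; lra.
Qed.

Lemma theta_term_dominated1 c z : exists M, cdominated r M (theta_term c z).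
Proof.
have [M hM] := theta_term_dominated c (\sum_i `|complex.Im (z i ord0)|).
by exists M; apply: hM => i; rewrite (bigD1 i)//= lerDl sumr_ge0.
Qed.

Lemma theta_translate c m z : theta (c + map_mx intr m) z = theta c z.
Proof.
have [M hM] := theta_term_dominated1 c z.
rewrite /theta -(lattice_sum_translate ratio_gt0 ratio_lt1 m hM).
congr lattice_sum; apply/funext => k; rewrite /theta_term; congr expC; congr theta_exponent.
by apply/matrixP => i j; rewrite !mxE intrD [c i j + _]addrC addrA.
Qed.

(** In the k-th term the exponent gains 2 pi i (k + c).m, and the integer k.m drops out. *)
Lemma theta_shift_int c m z :
  theta c (z + RtoC_mx (map_mx intr m)) = unit_exp (dotr c (map_mx intr m)) * theta c z.
Proof.
have [M hM] := theta_term_dominated1 c z.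
rewrite /theta -(lattice_sumZ ratio_gt0 ratio_lt1 _ hM).
congr lattice_sum; apply/funext => k; rewrite /theta_term -expCD.
rewrite /theta_exponent dotcDr dotc_real dotrDl.
have [l hl] : exists l : int, dotr (map_mx intr k) (map_mx intr m) = l%:~R :> R.
  exists (\sum_i k i ord0 * m i ord0); rewrite dotrE rmorph_sum.
  by apply: eq_bigr => i _; rewrite !mxE -intrM.
rewrite hl; have e1 : expC (2 * pi%:C * 'i * (l%:~R : R)%:C) = 1 by exact: unit_exp_int.
rewrite -[RHS]mul1r -[X in _ = X * _]e1 /unit_exp -!expCD; congr expC.
by move: pi%:C => p; rewrite rmorphD; ring.
Qed.

(** Completing the square in q(v + u), where symmetry of [A] is used. The vector [u] is any real
    one: integral vectors give quasi-periodicity, and n/d gives the move from c to c + u. *)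
Lemma theta_shift_tau c u z :
  theta c (z + tau *: RtoC_mx (A *m u)) =
  expC (- (pi%:C * 'i * (tau * (quad A u)%:C)) - 2 * pi%:C * 'i * dotc u z) *
  theta (c + u) z.
Proof.
have [M hM] := theta_term_dominated1 (c + u) z.
rewrite /theta -(lattice_sumZ ratio_gt0 ratio_lt1 _ hM).
congr lattice_sum; apply/funext => k; rewrite /theta_term -expCD; congr expC.
rewrite [map_mx intr k + (c + u)]addrA; move: (map_mx intr k + c) => v.
rewrite /theta_exponent quadD// dotcDr dotcZr dotc_real dotcDl; move: pi%:C => p.
rewrite !rmorphD rmorphM rmorph_nat; ring.
Qed.

(** On a box the imaginary parts of the argument are bounded, so one majorant serves all points and
    the partial sums over cubes converge uniformly. *)
Lemma theta_box_uc (J : finType) c (z : (J -> R) -> 'cV[R[i]]_g) :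
  (forall i, cbox_uc (fun x => z x i ord0)) -> cbox_uc (fun x => theta c (z x)).
Proof.
move=> uz.
have unif B : exists M, forall x, in_box B x -> cdominated r M (theta_term c (z x)).
  have /choice[Bi hBi] : forall i, exists b, 0 <= b /\ forall x, in_box B x ->
      `|complex.Im (z x i ord0)| <= b.
    by move=> i; have [b b0 hb] := box_uc_bound B (proj2 (uz i)); exists b; split=> //; exact: ltW.
  have [M hM] := theta_term_dominated c (\sum_i Bi i); exists M => x hx; apply: hM => i.
  have [_ /(_ _ hx) h] := hBi i; apply: le_trans h _.
  by rewrite (bigD1 i)//= lerDl sumr_ge0// => j _; case: (hBi j).
have uterm k : cbox_uc (fun x => theta_term c (z x) k).
  apply: cbox_uc_expC; apply: cbox_ucD; first exact: cbox_uc_cst.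
  apply: cbox_ucM; first exact: cbox_uc_cst.
  by apply: cbox_uc_sum => i _; apply: cbox_ucM => //; exact: cbox_uc_cst.
have usum (s : seq 'cV[int]_g) : cbox_uc (fun x => \sum_(k <- s) theta_term c (z x) k).
  by apply: cbox_uc_sum.
split.
- apply: (@box_uc_unif_lim _ _ (fun N x => cube_sum (fun k => complex.Re (theta_term c (z x) k)) N)).
    move=> N; have [+ _] := usum (cube_seq g N); by under eq_fun do rewrite Re_sum.
  move=> B e e0; have [M hM] := unif B.
  have [N hN] := @cube_sum_tail0 _ g _ ratio_gt0 ratio_lt1 M e e0; exists N => x hx.
  rewrite /theta (lattice_sum_lim ratio_gt0 ratio_lt1 (hM x hx)) /=.
  by apply: le_trans hN; apply: cube_sum_tail; [exact: ratio_gt0|exact: ratio_lt1|case: (hM x hx)].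
- apply: (@box_uc_unif_lim _ _ (fun N x => cube_sum (fun k => complex.Im (theta_term c (z x) k)) N)).
    move=> N; have [_ +] := usum (cube_seq g N); by under eq_fun do rewrite Im_sum.
  move=> B e e0; have [M hM] := unif B.
  have [N hN] := @cube_sum_tail0 _ g _ ratio_gt0 ratio_lt1 M e e0; exists N => x hx.
  rewrite /theta (lattice_sum_lim ratio_gt0 ratio_lt1 (hM x hx)) /=.
  by apply: le_trans hN; apply: cube_sum_tail; [exact: ratio_gt0|exact: ratio_lt1|case: (hM x hx)].
Qed.

End ThetaFunction.

(** * The function vartheta *)

Section Vartheta.
Variables (R : realType) (tau : R[i]) (htau : 0 < complex.Im tau).

Let one1 : 'M[R]_1 := 1%:M.

Lemma one1_sym : one1^T = one1.
Proof. exact: trmx1. Qed.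

Lemma one1_pos : posdef one1.
Proof.
move=> v v0; rewrite mulmx1 mxE big_ord1 mxE -expr2 lt_neqAle sqr_ge0 andbT eq_sym sqrf_eq0.
by apply: contra v0 => /eqP v0; apply/eqP/matrixP => i j; rewrite !ord1 v0 mxE.
Qed.

Local Notation half := (const_mx 2^-1 : 'cV[R]_1).

Lemma quad_one1 (v : 'cV[R]_1) : quad one1 v = v ord0 ord0 ^+ 2.
Proof. by rewrite /quad mul1mx dotrE big_ord1. Qed.

(** The case g = 1 of [theta] for the form 1, with characteristic 1/2; periods and continuity of
    [vartheta] are read off from there. *)
Lemma varthetaE z : vartheta tau z = theta tau one1 half (const_mx (z + 2^-1)).
Proof.
rewrite /vartheta /theta; congr lattice_sum; apply/funext => k; rewrite /theta_term /theta_exponent.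
rewrite quad_one1 /dotc big_ord1 !mxE; congr expC.
set v : R[i] := _%:~R + _; have -> : v = ((k ord0 ord0)%:~R + 2^-1 : R)%:C.
  by rewrite rmorphD rmorph_int fmorphV rmorph_nat.
by rewrite rmorphXn /= !mulrA.
Qed.

(** The sign -1 is kept as an exponential so that the factors of many pairs can be combined by
    adding exponents. *)
Lemma varthetaD1 z : vartheta tau (z + 1) = expC (pi%:C * 'i) * vartheta tau z.
Proof.
rewrite !varthetaE.
have -> : const_mx (z + 1 + 2^-1) =
    const_mx (z + 2^-1) + RtoC_mx (map_mx intr (const_mx 1 : 'cV[int]_1)) :> 'cV[R[i]]_1.
  by apply/matrixP => i j; rewrite !mxE rmorph1; ring.
rewrite (theta_shift_int htau one1_sym one1_pos).
rewrite expC_pi_i unit_expE dotrE big_ord1 !mxE mulr1.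
by rewrite mulrAC mulfV// mul1r cospi sinpi; congr (_ * _); apply: complexP; rewrite /= ?oppr0.
Qed.

Lemma varthetaDtau z : vartheta tau (z + tau) =
  expC (pi%:C * 'i - pi%:C * 'i * tau - 2 * pi%:C * 'i * z) * vartheta tau z.
Proof.
rewrite !varthetaE.
have -> : const_mx (z + tau + 2^-1) =
    const_mx (z + 2^-1) + tau *: RtoC_mx (one1 *m const_mx 1) :> 'cV[R[i]]_1.
  by apply/matrixP => i j; rewrite mul1mx !mxE rmorph1; ring.
rewrite (theta_shift_tau htau one1_sym one1_pos).
have -> : half + const_mx 1 = half + map_mx intr (const_mx 1 : 'cV[int]_1).
  by apply/matrixP => i j; rewrite !mxE.
rewrite (theta_translate htau one1_sym one1_pos).
congr (_ * _); rewrite quad_one1 /dotc big_ord1 !mxE expr1n.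
(* [theta_shift_tau] yields - pi i from the argument z + 1/2; it is replaced by + pi i, as in
   [varthetaD1], at the cost of a factor exp (- 2 pi i) = 1. *)
transitivity (expC (pi%:C * 'i - pi%:C * 'i * tau - 2 * pi%:C * 'i * z + 2 * pi%:C * 'i * (-1)%:C)).
  congr expC; move: pi%:C => p; rewrite rmorphN rmorph1; field; rewrite ?pnatr_eq0//.
rewrite expCD (_ : expC (_ * (-1)%:C) = 1) ?mulr1//.
by have := @unit_exp_int R (-1); rewrite /unit_exp mulrN1z.
Qed.

(** These are the full periods 1 and [tau] of E, selected by a Boolean so that one computation
    covers both directions. *)
Definition half_period (b : bool) : R[i] := if b then tau else 1.

(** A logarithm of the multiplier of [vartheta]. It is affine in [z], so that its sums over pairs
    reduce to the row sums of K n. *)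
Definition shift_factor (b : bool) (z : R[i]) : R[i] :=
  if b then pi%:C * 'i - pi%:C * 'i * tau - 2 * pi%:C * 'i * z else pi%:C * 'i.

Lemma varthetaD b z :
  vartheta tau (z + half_period b) = expC (shift_factor b z) * vartheta tau z.
Proof. by case: b; [exact: varthetaDtau|exact: varthetaD1]. Qed.

(** The mirror image of [varthetaD] at -z, as the oddness of theta suggests. In exponents: with P
    the period, the values of [shift_factor b] at -z and at z - P add up to 2 pi i. *)
Lemma varthetaB b z :
  vartheta tau (z - half_period b) = expC (shift_factor b (- z)) * vartheta tau z.
Proof.
have := varthetaD b (z - half_period b); rewrite subrK => ->.
rewrite mulrA -expCD -[LHS]mul1r; congr (_ * _).
transitivity (expC (2 * pi%:C * 'i : R[i])); first by rewrite expC_2pi_i.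
congr expC.
by case: b; rewrite /shift_factor /half_period; move: pi%:C => p; ring.
Qed.

Lemma vartheta_box_uc (J : finType) (z : (J -> R) -> R[i]) :
  cbox_uc z -> cbox_uc (fun x => vartheta tau (z x)).
Proof.
move=> uz; apply: (@eq_cbox_uc _ _ (fun x => theta tau one1 half (const_mx (z x + 2^-1)))).
  apply: (theta_box_uc htau one1_sym one1_pos) => i.
  by under [fun x => _]eq_fun do rewrite mxE; apply: cbox_ucD => //; exact: cbox_uc_cst.
by move=> x; rewrite varthetaE.
Qed.

End Vartheta.

(** * Sums over unordered pairs of coordinates *)

Section PairSums.
Variables (V : zmodType).

Lemma sum_ordered_pairs n (F : 'I_n -> 'I_n -> V) :
  \sum_(i < n) \sum_(j < n | (i < j)%N) (F i j + F j i) = \sum_i \sum_j F i j - \sum_i F i i.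
Proof.
under eq_bigr do rewrite big_split.
rewrite big_split /= [X in _ + X](exchange_big_dep predT)//= -big_split -sumrB /=.
apply: eq_bigr => i _.
rewrite [in RHS](bigD1 i)//= [F i i + _]addrC addrK [in RHS](bigID (fun j : 'I_n => (i < j)%N))/=.
by congr (_ + _); apply: eq_bigl => j; rewrite -val_eqE /=; case: ltngtP.
Qed.

(** The left side follows the two products in [wave], pairs within a block and pairs between blocks.
    Symmetry of [K] turns it into a full sum over ordered pairs minus the diagonal, the form to
    which K n = d e applies. *)
Lemma sum_unordered_coords g (n : 'I_g -> nat) (K : 'I_g -> 'I_g -> nat)
    (F : forall k l, 'I_(n k) -> 'I_(n l) -> V) : (forall k l, K k l = K l k) ->
  \sum_(k < g) \sum_(p < n k) \sum_(q < n k | (p < q)%N) (F k k p q + F k k q p) *+ K k k +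
  \sum_(k < g) \sum_(l < g | (k < l)%N) \sum_p \sum_q (F k l p q + F l k q p) *+ K k l =
  \sum_k \sum_l (\sum_p \sum_q F k l p q) *+ K k l - \sum_k (\sum_p F k k p p) *+ K k k.
Proof.
move=> Ksym.
pose G k l := (\sum_p \sum_q F k l p q) *+ K k l.
have -> : \sum_(k < g) \sum_(l < g | (k < l)%N) \sum_p \sum_q (F k l p q + F l k q p) *+ K k l =
    \sum_(k < g) \sum_(l < g | (k < l)%N) (G k l + G l k).
  apply: eq_bigr => k _; apply: eq_bigr => l _.
  rewrite /G (Ksym l k) -mulrnDl -[X in _ + X]exchange_big -big_split -sumrMnl.
  apply: eq_bigr => p _; rewrite -big_split -sumrMnl; exact: eq_bigr.
have -> : \sum_(k < g) \sum_(p < n k) \sum_(q < n k | (p < q)%N) (F k k p q + F k k q p) *+ K k k =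
    \sum_k G k k - \sum_k (\sum_p F k k p p) *+ K k k.
  rewrite -sumrB; apply: eq_bigr => k _.
  rewrite /G -mulrnBl -sum_ordered_pairs -sumrMnl.
  by apply: eq_bigr => p _; rewrite -sumrMnl.
by rewrite sum_ordered_pairs addrC addrA subrK.
Qed.

End PairSums.

(** * Quasi-periodicity of the wave functions *)

Section WaveShifts.
Variables (R : realType) (tau : R[i]) (htau : 0 < complex.Im tau).
Variables (g : nat) (K : 'M[nat]_g) (n : 'cV[nat]_g) (d : nat) (xi : 'cV[R[i]]_g).
Hypothesis hWen : Wen_datum R K n d.
Local Notation coord := (Defs.coord n).
Local Notation cc p := (Tagged (fun k => 'I_(n k ord0)) p : coord).
Local Notation KR := (Kreal R K).
Implicit Types (z : coord -> R[i]) (c : 'cV[R]_g) (b : bool).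

Lemma Kreal_sym : KR^T = KR.
Proof. by rewrite /Kreal map_trmx; case: hWen => -[-> _]. Qed.

Lemma Kreal_posdef : posdef KR.
Proof. by case: hWen => -[]. Qed.

Lemma Kreal_unit : KR \in unitmx.
Proof. exact: posdef_unitmx Kreal_posdef. Qed.

Lemma Wen_sym k l : K k l = K l k.
Proof. by case: hWen => -[Ks _ _ _] _ _ _; rewrite -{1}Ks mxE. Qed.

Lemma Wen_d_gt0 : (0 < d)%N.
Proof. by case: hWen. Qed.

Lemma Wen_row_sum k : (\sum_l K k l * n l ord0 = d)%N.
Proof.
case: hWen => _ _ _ /matrixP /(_ k ord0); rewrite !mxE => <-.
by apply: eq_bigr.
Qed.

Definition pair_product z : R[i] :=
  (\prod_(k < g) \prod_(p < n k ord0) \prod_(q < n k ord0 | (p < q)%N)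
       vartheta tau (zc z p - zc z q) ^+ K k k)
  * (\prod_(k < g) \prod_(l < g | (k < l)%N)
       \prod_(p < n k ord0) \prod_(q < n l ord0)
         vartheta tau (zc z p - zc z q) ^+ K k l).

Definition wave_argument z : 'cV[R[i]]_g := RtoC_mx KR *m wvec z + xi.

Lemma waveE c z :
  wave tau K xi c z = theta tau KR c (wave_argument z) * pair_product z.
Proof.
rewrite /wave -mulrA ThetaE; congr (theta _ _ _ _ * _).
by rewrite (_ : RtoC_mx 0 = 0) ?addr0//; apply/matrixP => i j; rewrite !mxE.
Qed.

Definition shift_coord z (a : coord) (h : R[i]) : coord -> R[i] :=
  fun e => z e + h *+ (e == a).

Lemma sum_coord_delta (V : zmodType) (G : forall k, 'I_(n k ord0) -> V)
    k0 (p0 : 'I_(n k0 ord0)) :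
  \sum_k \sum_(p < n k ord0) G k p *+ (cc p == cc p0) = G k0 p0.
Proof.
rewrite (bigD1 k0)//= (bigD1 p0)//= eqxx mulr1n !big1 ?addr0//.
  move=> k kk0; rewrite big1// => p _; case: eqP => // /(congr1 tag) /= e.
  by rewrite e eqxx in kk0.
by move=> p pp0; rewrite eq_Tagged /= (negbTE pp0).
Qed.

Definition shift_slope b : R[i] := if b then 2 * pi%:C * 'i else 0.

Lemma shift_factorE b w :
  shift_factor tau b w = shift_factor tau b 0 - shift_slope b * w.
Proof. by case: b; rewrite /shift_factor /shift_slope; ring. Qed.

(** Moving [e] adds the period to the difference and moving [f] subtracts it, so the second exponent
    is the first with the roles exchanged. As [e != f], at most one of them is present. *)
Lemma vartheta_shift_coord z a b (e f : coord) : e != f ->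
  vartheta tau (shift_coord z a (half_period tau b) e - shift_coord z a (half_period tau b) f) =
  expC (shift_factor tau b (z e - z f) *+ (e == a) +
        shift_factor tau b (z f - z e) *+ (f == a)) * vartheta tau (z e - z f).
Proof.
rewrite /shift_coord; have [->|ea] := eqVneq e a; have [->|fa] := eqVneq f a => ef.
- by [].
- rewrite mulr0n !addr0 !mulr1n -varthetaD//; congr vartheta; ring.
- rewrite mulr0n add0r addr0 !mulr1n -[z a - z e]opprB -varthetaB//; congr vartheta; ring.
- by rewrite !mulr0n !addr0 expC0 mul1r.
Qed.

(** Each pair containing the moved coordinate contributes [shift_factor] at its difference, an
    affine function of slope [- shift_slope b]. The weights [K] sum to [d], less the diagonal entry
    for the coordinate paired with itself, at difference 0. *)
Lemma pair_product_shift_coord z k0 (p0 : 'I_(n k0 ord0)) b :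
  pair_product (shift_coord z (cc p0) (half_period tau b)) =
  expC (shift_factor tau b 0 * (d%:R - (K k0 k0)%:R) -
        shift_slope b * (d%:R * z (cc p0) - (RtoC_mx KR *m wvec z) k0 ord0)) *
  pair_product z.
Proof.
(* The exponent is charged to the ordered pair whose first member moves; [F k l p q + F l k q p]
   then covers both members of an unordered pair. *)
pose F k l (p : 'I_(n k ord0)) (q : 'I_(n l ord0)) : R[i] :=
  shift_factor tau b (z (cc p) - z (cc q)) *+ (cc p == cc p0).
have step k l (p : 'I_(n k ord0)) (q : 'I_(n l ord0)) m : cc p != cc q ->
    vartheta tau (zc (shift_coord z (cc p0) (half_period tau b)) p -
      zc (shift_coord z (cc p0) (half_period tau b)) q) ^+ m =
    expC ((F k l p q + F l k q p) *+ m) * vartheta tau (zc z p - zc z q) ^+ m.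
  by move=> pq; rewrite vartheta_shift_coord// exprMn expC_mulrn.
rewrite /pair_product.
under eq_bigr => k _.
  under eq_bigr => p _.
    under eq_bigr => q pq.
      rewrite step; last by rewrite eq_Tagged /= -val_eqE /= ltn_eqF.
      over.
    rewrite big_split -expC_sum; over.
  rewrite big_split -expC_sum; over.
rewrite big_split -expC_sum.
under [X in _ * X]eq_bigr => k _.
  under eq_bigr => l kl.
    under eq_bigr => p _.
      under eq_bigr => q _.
        rewrite step; last first.
          by apply/eqP => /(congr1 tag) /= e; rewrite e ltnn in kl.
        over.
      rewrite big_split -expC_sum; over.
    rewrite big_split -expC_sum; over.
  rewrite big_split -expC_sum; over.
rewrite big_split -expC_sum mulrACA -expCD /=.
rewrite (sum_unordered_coords F) => [|*]; last exact: Wen_sym.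
congr (expC _ * _).
have -> : \sum_k (\sum_(p < n k ord0) F k k p p) *+ K k k =
    shift_factor tau b 0 *+ K k0 k0.
  transitivity (\sum_k \sum_(p < n k ord0)
      (shift_factor tau b 0 *+ K k k) *+ (cc p == cc p0)).
    apply: eq_bigr => k _; rewrite -sumrMnl; apply: eq_bigr => p _.
    by rewrite /F subrr mulrnAC.
  exact: (sum_coord_delta (fun k _ => shift_factor tau b 0 *+ K k k)).
have -> : \sum_k \sum_l (\sum_(p < n k ord0) \sum_(q < n l ord0) F k l p q) *+ K k l =
    \sum_l \sum_(q < n l ord0) shift_factor tau b (z (cc p0) - z (cc q)) *+ K k0 l.
  transitivity (\sum_k \sum_(p < n k ord0)
      (\sum_l \sum_(q < n l ord0) shift_factor tau b (z (cc p) - z (cc q)) *+ K k l)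
        *+ (cc p == cc p0)).
    apply: eq_bigr => k _.
    under eq_bigr do rewrite -sumrMnl.
    rewrite exchange_big; apply: eq_bigr => p _ /=; rewrite -sumrMnl.
    apply: eq_bigr => l _; rewrite -!sumrMnl; apply: eq_bigr => q _.
    by rewrite mulrnAC.
  exact: (sum_coord_delta (fun k p => \sum_l \sum_(q < n l ord0)
    shift_factor tau b (z (cc p) - z (cc q)) *+ K k l)).
set al := shift_factor tau b 0; set be := shift_slope b.
have -> : \sum_l \sum_(q < n l ord0) shift_factor tau b (z (cc p0) - z (cc q)) *+ K k0 l =
    \sum_l ((al - be * z (cc p0)) * (K k0 l * n l ord0)%N%:R + be * ((K k0 l)%:R * wvec z l ord0)).
  apply: eq_bigr => l _; rewrite mxE.
  under eq_bigr => q _.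
    rewrite shift_factorE -/al -/be (_ : _ *+ _ = (al - be * z (cc p0)) * (K k0 l)%:R
      + be * ((K k0 l)%:R * z (cc q))); last by rewrite -mulr_natr; ring.
    over.
  rewrite big_split /= sumr_const card_ord -!mulr_sumr; congr (_ + _).
  by rewrite -[LHS]mulr_natr natrM mulrA.
rewrite big_split -!mulr_sumr -natr_sum Wen_row_sum /=.
have -> : (RtoC_mx KR *m wvec z) k0 ord0 = \sum_l (K k0 l)%:R * wvec z l ord0.
  by rewrite mxE; apply: eq_bigr => l _; rewrite !mxE rmorph_nat.
rewrite -mulr_natr; ring.
Qed.

Lemma wvec_shift_coord z k0 (p0 : 'I_(n k0 ord0)) (h : R[i]) :
  wvec (shift_coord z (cc p0) h) = wvec z + h *: RtoC_mx (delta_mx k0 ord0).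
Proof.
apply/matrixP => k j; rewrite (ord1 j) !mxE eqxx andbT.
rewrite /zc /shift_coord big_split /=; congr (_ + _).
have [->|kk0] := eqVneq k k0.
  rewrite (bigD1 p0)//= eqxx big1 ?addr0 ?mulr1 ?mulr1n// => p pp0.
  by rewrite eq_Tagged /= (negbTE pp0).
rewrite mulr0 big1// => p _; case: eqP => // /(congr1 tag) /= e.
by rewrite e eqxx in kk0.
Qed.

Lemma RtoC_mxM (m1 m2 m3 : nat) (A : 'M[R]_(m1, m2)) (B : 'M[R]_(m2, m3)) :
  RtoC_mx (A *m B) = RtoC_mx A *m RtoC_mx B.
Proof. exact: map_mxM. Qed.

Lemma wave_argument_shift_coord z k0 (p0 : 'I_(n k0 ord0)) (h : R[i]) :
  wave_argument (shift_coord z (cc p0) h) =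
  wave_argument z + h *: RtoC_mx (KR *m delta_mx k0 ord0).
Proof.
by rewrite /wave_argument wvec_shift_coord mulmxDr -scalemxAr RtoC_mxM addrAC.
Qed.

Lemma Kreal_delta k0 :
  KR *m delta_mx k0 ord0 = map_mx intr (map_mx Posz (col k0 K)) :> 'cV[R]_g.
Proof. by rewrite -colE; apply/matrixP => i j; rewrite !mxE. Qed.

(** The argument of theta moves by the column K e_k, whose pairing with c in K^-1 Z^g is an integer;
    so theta contributes 1 and the multiplier is that of the pair product. *)
Lemma wave_shift_coord1 c z k0 (p0 : 'I_(n k0 ord0)) : in_KinvZg K c ->
  wave tau K xi c (shift_coord z (cc p0) 1) =
  expC (pi%:C * 'i * (d%:R - (K k0 k0)%:R)) * wave tau K xi c z.
Proof.
move=> [m cm]; rewrite !waveE (pair_product_shift_coord z p0 false) wave_argument_shift_coord scale1r.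
rewrite {1}Kreal_delta (theta_shift_int htau Kreal_sym Kreal_posdef).
rewrite -Kreal_delta dotr_mulmx ?Kreal_sym// cm mulmxA mulmxV ?Kreal_unit// mul1mx.
have -> : dotr (map_mx intr m) (delta_mx k0 ord0) = (m k0 ord0)%:~R :> R.
  rewrite dotrE (bigD1 k0)//= big1 ?addr0 => [|k kk0]; rewrite !mxE ?eqxx ?mulr1//.
  by rewrite (negbTE kk0) mulr0.
rewrite unit_exp_int mul1r mulrCA; congr (expC _ * _).
by rewrite /shift_slope mul0r subr0.
Qed.

(** Theta contributes - pi i tau K_kk - 2 pi i (K w + xi)_k; the terms in tau K_kk and in K w cancel
    against the pair product. What remains involves only the moved coordinate and not [c]. *)
Lemma wave_shift_coord_tau c z k0 (p0 : 'I_(n k0 ord0)) :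
  wave tau K xi c (shift_coord z (cc p0) tau) =
  expC (pi%:C * 'i * (d%:R - (K k0 k0)%:R - tau * d%:R)
        - 2 * pi%:C * 'i * (d%:R * z (cc p0) + xi k0 ord0)) * wave tau K xi c z.
Proof.
rewrite !waveE (pair_product_shift_coord z p0 true) wave_argument_shift_coord.
rewrite (theta_shift_tau htau Kreal_sym Kreal_posdef).
have -> : c + delta_mx k0 ord0 = c + map_mx intr (delta_mx k0 ord0).
  by congr (_ + _); apply/matrixP => i j; rewrite !mxE; case: (_ && _).
rewrite (theta_translate htau Kreal_sym Kreal_posdef).
have dotd (w : 'cV[R[i]]_g) : dotc (delta_mx k0 ord0) w = w k0 ord0.
  rewrite /dotc (bigD1 k0)//= big1 ?addr0 => [|k kk0]; rewrite !mxE ?eqxx ?mul1r//.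
  by rewrite (negbTE kk0) mul0r.
have -> : quad KR (delta_mx k0 ord0) = (K k0 k0)%:R.
  rewrite /quad dotrE (bigD1 k0)//= big1 ?addr0 => [|k kk0]; rewrite !mxE ?eqxx ?mul1r.
    rewrite (bigD1 k0)//= big1 ?addr0 => [|k kk0]; rewrite !mxE ?eqxx ?mulr1//.
    by rewrite (negbTE kk0) mulr0.
  by rewrite (negbTE kk0) mul0r.
rewrite dotd mulrACA -expCD; congr (expC _ * _).
rewrite /wave_argument [in LHS]mxE rmorph_nat /shift_factor /shift_slope.
by move: pi%:C => p; ring.
Qed.

Lemma pair_product_translate z (h : R[i]) :
  pair_product (fun a => z a + h) = pair_product z.
Proof.
have e k l (p : 'I_(n k ord0)) (q : 'I_(n l ord0)) :
    zc (fun a => z a + h) p - zc (fun a => z a + h) q = zc z p - zc z q.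
  by rewrite /zc; ring.
rewrite /pair_product; congr (_ * _).
  by do 3 (apply: eq_bigr => ? _); rewrite e.
by do 4 (apply: eq_bigr => ? _); rewrite e.
Qed.

Definition frac_n : 'cV[R]_g := \col_k ((n k ord0)%:R / d%:R).

Lemma Kreal_frac_n : KR *m frac_n = const_mx 1.
Proof.
apply/matrixP => i j; rewrite !mxE.
under eq_bigr do rewrite !mxE mulrA -natrM.
by rewrite -mulr_suml -natr_sum Wen_row_sum mulfV// pnatr_eq0 -lt0n Wen_d_gt0.
Qed.

Lemma wave_argument_translate z (h : R[i]) :
  wave_argument (fun a => z a + h / d%:R) =
  wave_argument z + h *: RtoC_mx (KR *m frac_n).
Proof.
rewrite /wave_argument addrAC; congr (_ + _); rewrite RtoC_mxM scalemxAr -mulmxDr.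
congr (_ *m _); apply/matrixP => k j; rewrite !mxE /zc big_split; congr (_ + _).
rewrite sumr_const card_ord rmorphM fmorphV !rmorph_nat -[LHS]mulr_natr; ring.
Qed.

Lemma wave_translate1 c z : wave tau K xi c (fun a => z a + 1 / d%:R) =
  unit_exp (\sum_k c k ord0) * wave tau K xi c z.
Proof.
rewrite !waveE pair_product_translate wave_argument_translate scale1r Kreal_frac_n.
have e1 : const_mx 1 = map_mx intr (const_mx 1) :> 'cV[R]_g.
  by apply/matrixP => i j; rewrite !mxE.
rewrite {1}e1 (theta_shift_int htau Kreal_sym Kreal_posdef).
rewrite mulrA; congr (unit_exp _ * _ * _); rewrite dotrE.
by apply: eq_bigr => k _; rewrite !mxE mulr1.
Qed.

(** [theta_shift_tau] at u = n/d. Since K u = e and [K] is symmetric, q(u) = u.e and u.(K w + xi) =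
    e.w + u.xi. *)
Lemma wave_translate_tau c z : wave tau K xi c (fun a => z a + tau / d%:R) =
  expC (- (pi%:C * 'i * (tau * (\sum_k (n k ord0)%:R / d%:R : R)%:C))
        - 2 * pi%:C * 'i * (\sum_k \sum_p zc z (k := k) p +
            \sum_k ((n k ord0)%:R / d%:R : R)%:C * xi k ord0)) *
  wave tau K xi (c + frac_n) z.
Proof.
rewrite !waveE pair_product_translate wave_argument_translate.
rewrite (theta_shift_tau htau Kreal_sym Kreal_posdef).
rewrite -[LHS]mulrA /quad Kreal_frac_n.
have -> : dotr frac_n (const_mx 1) = \sum_k (n k ord0)%:R / d%:R.
  by rewrite dotrE; apply: eq_bigr => k _; rewrite !mxE mulr1.
suff -> : dotc frac_n (wave_argument z) = \sum_k \sum_p zc z (k := k) p +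
    \sum_k ((n k ord0)%:R / d%:R : R)%:C * xi k ord0 by [].
rewrite /wave_argument dotcDr; congr (_ + _); last by apply: eq_bigr => k _; rewrite !mxE.
rewrite /dotc; under eq_bigr do rewrite [(_ *m _) _ _]mxE mulr_sumr.
rewrite exchange_big /=; apply: eq_bigr => l _.
under eq_bigr do rewrite mulrA.
rewrite -mulr_suml (_ : \sum_k _ = 1) ?mul1r ?mxE//.
have /matrixP /(_ l ord0) := Kreal_frac_n; rewrite !mxE => /(congr1 (fun x : R => x%:C)).
rewrite rmorph1 rmorph_sum => <-; apply: eq_bigr => k _.
by rewrite !mxE Wen_sym mulrC -rmorphM.
Qed.

Lemma wave_translate_int c m z :
  wave tau K xi (c + map_mx intr m) z = wave tau K xi c z.
Proof. by rewrite !waveE (theta_translate htau Kreal_sym Kreal_posdef). Qed.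

Lemma wave_box_uc (J : finType) c (z : (J -> R) -> coord -> R[i]) :
  (forall a, cbox_uc (fun x => z x a)) -> cbox_uc (fun x => wave tau K xi c (z x)).
Proof.
move=> uz; apply: (@eq_cbox_uc _ _ (fun x => theta tau KR c (wave_argument (z x)) * pair_product (z x))).
  have uv k l (p : 'I_(n k ord0)) (q : 'I_(n l ord0)) m :
      cbox_uc (fun x => vartheta tau (zc (z x) p - zc (z x) q) ^+ m).
    by apply: cbox_ucX; apply: vartheta_box_uc => //; apply: cbox_ucB; exact: uz.
  apply: cbox_ucM; last by apply: cbox_ucM; do !(apply: cbox_uc_prod => ? _).
  apply: (theta_box_uc htau Kreal_sym Kreal_posdef) => i.
  under [fun x => _]eq_fun do rewrite !mxE.
  apply: cbox_ucD; last exact: cbox_uc_cst.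
  apply: cbox_uc_sum => l _; apply: cbox_ucM; first exact: cbox_uc_cst.
  by under [fun x => _]eq_fun do rewrite mxE; apply: cbox_uc_sum => p _; exact: uz.
by move=> x; rewrite waveE.
Qed.

End WaveShifts.

(** * The Gram matrix *)

Section GramMatrix.
Variables (R : realType) (tau : R[i]) (htau : 0 < complex.Im tau).
Variables (g : nat) (K : 'M[nat]_g) (n : 'cV[nat]_g) (d : nat) (xi : 'cV[R[i]]_g).
Hypothesis hWen : Wen_datum R K n d.
Local Notation coord := (Defs.coord n).
Local Notation cc p := (Tagged (fun k => 'I_(n k ord0)) p : coord).
Local Notation wave := (@wave R tau g K n xi).
Local Notation u := (frac_n R n d).
Local Notation t := (complex.Im tau).
Implicit Types (x y : coord -> R) (c : 'cV[R]_g).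

Definition cover_point x y : coord -> R[i] := fun a => (x a)%:C + tau * (y a)%:C.

Definition integrand c c' x y : R[i] :=
  wave c (cover_point x y) * Num.conj (wave c' (cover_point x y))
  * (weight tau d xi y)%:C.

Lemma scalar_productE c c' : scalar_product tau d xi (wave c) (wave c') =
  double_integral (fun x y => complex.Re (integrand c c' x y))
  +i* double_integral (fun x y => complex.Im (integrand c c' x y)).
Proof. by []. Qed.

(** The bracket doubled in the exponent is the real part of the exponent in [wave_shift_coord_tau],
    as [integrand_factor] requires; here a_k t = Im xi_k. *)
Lemma weight_shift_coord y k (p : 'I_(n k ord0)) :
  weight tau d xi (upd y (cc p) (y (cc p) + 1)) =
  expR (- (2 * (pi * t * d%:R + 2 * pi * (d%:R * (t * y (cc p)) + complex.Im (xi k 0))))) *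
  weight tau d xi y.
Proof.
rewrite /weight (bigD1 (cc p))//= [in RHS](bigD1 (cc p))//= [RHS]mulrA -expRD upd_val.
congr (expR _ * _).
  by rewrite /xi_a /=; field; rewrite lt0r_neq0.
by apply: eq_bigr => a /negbTE ap; rewrite /upd ap.
Qed.

Lemma sum_coord (V : nmodType) (f : coord -> V) :
  \sum_a f a = \sum_k \sum_(p < n k ord0) f (cc p).
Proof.
rewrite (sig_big_dep xpredT (fun _ => xpredT) (fun k p => f (cc p))).
by apply: eq_bigr => -[].
Qed.

(** Again the doubled bracket is the real part of the exponent in [wave_translate_tau]. After
    completion of the difference of squares, each coordinate of block k contributes equally up to
    its linear term, whence the factors n_k. *)
Lemma weight_translate y : weight tau d xi (fun a => y a + 1 / d%:R) =
  expR (- (2 * (pi * t * (\sum_k (n k ord0)%:R / d%:R) + 2 * pi *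
    (\sum_a t * y a + \sum_k (n k ord0)%:R / d%:R * complex.Im (xi k 0))))) *
  weight tau d xi y.
Proof.
have d0 : d%:R != 0 :> R by rewrite pnatr_eq0 -lt0n (Wen_d_gt0 hWen).
rewrite /weight -!expR_sum -expRD; congr expR; apply/eqP; rewrite -subr_eq -sumrB; apply/eqP.
under eq_bigr => a _.
  rewrite (_ : _ - _ = - (2 * (2 * pi * (t * y a))) +
      (- (2 * (pi * t / d%:R + 2 * pi * (complex.Im (xi (tag a) 0) / d%:R))))); last first.
    by rewrite /xi_a; field; rewrite d0 lt0r_neq0.
  over.
rewrite big_split /= sumrN -!mulr_sumr [X in _ + X]sum_coord.
under [X in _ + X]eq_bigr => k _ do rewrite /= sumr_const card_ord.
rewrite [X in _ + X](_ : _ = - (2 * (pi * t * (\sum_k (n k ord0)%:R / d%:R) +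
   2 * pi * \sum_k (n k ord0)%:R / d%:R * complex.Im (xi k 0)))); last first.
  rewrite ![in RHS]mulr_sumr -big_split [in RHS]mulr_sumr -sumrN /=.
  by apply: eq_bigr => k _; rewrite -[LHS]mulr_natr; ring.
ring.
Qed.

Lemma box_uc_weight (J : finType) (y : (J -> R) -> coord -> R) :
  (forall a, box_uc (fun w => y w a)) -> cbox_uc (fun w => (weight tau d xi (y w))%:C).
Proof.
move=> uy; split; last exact: box_uc_cst.
have [+ _] : cbox_uc (fun w => \prod_(a : coord) (expR
    (- 2 * pi * d%:R * t * y w a ^+ 2 - 4 * pi * xi_a tau xi (tag a) * t * y w a))%:C).
  apply: cbox_uc_prod => a _; split; last exact: box_uc_cst.
  apply: box_uc_expR; apply: box_ucB; apply: box_ucM; rewrite ?expr2; try exact: box_uc_cst.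
    by under eq_fun do rewrite expr2; exact: box_ucM.
  exact: uy.
by under eq_fun do rewrite -rmorph_prod /=.
Qed.

Lemma integrand_uc c c' :
  cbox_uc (fun w => integrand c c' (fst_half w) (snd_half w)).
Proof.
have uz a : cbox_uc (fun w : coord + coord -> R => cover_point (fst_half w) (snd_half w) a).
  apply: cbox_ucD; first exact: cbox_uc_proj.
  by apply: cbox_ucM; [exact: cbox_uc_cst|exact: cbox_uc_proj].
have uwave e := @wave_box_uc R tau htau g K n d xi hWen _ e _ uz.
apply: cbox_ucM; first by apply: cbox_ucM => //; exact: cbox_uc_conj.
by apply: box_uc_weight => a; exact: box_uc_proj.
Qed.

Lemma cover_point_upd_fst x y (a : coord) :
  cover_point (upd x a (x a + 1)) y = shift_coord (cover_point x y) a 1.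
Proof.
apply/funext => e; rewrite /cover_point /shift_coord /upd; case: eqP => [->|_].
  by rewrite rmorphD rmorph1 mulr1n; ring.
by rewrite addr0.
Qed.

Lemma cover_point_upd_snd x y (a : coord) :
  cover_point x (upd y a (y a + 1)) = shift_coord (cover_point x y) a tau.
Proof.
apply/funext => e; rewrite /cover_point /shift_coord /upd; case: eqP => [->|_].
  by rewrite rmorphD rmorph1 mulr1n; ring.
by rewrite addr0.
Qed.

(* The factors of [wave c] and [wave c'] under a period are the same number
   [expC E], so only its squared modulus matters. *)
Lemma integrand_factor c c' x y x' y' (E : R[i]) :
  wave c (cover_point x' y') = expC E * wave c (cover_point x y) ->
  wave c' (cover_point x' y') = expC E * wave c' (cover_point x y) ->
  weight tau d xi y' = expR (- (2 * complex.Re E)) * weight tau d xi y ->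
  integrand c c' x' y' = integrand c c' x y.
Proof.
move=> e1 e2 e3; rewrite /integrand e1 e2 e3.
move: (wave c _) (wave c' _) (weight _ _ _ _) => w w' v.
rewrite rmorphM mulrACA expC_mul_conj rmorphM mulrACA.
by rewrite -rmorphM -expRD subrr expR0 mul1r.
Qed.

Lemma integrand_periodic_fst c c' (a : coord) x y : in_KinvZg K c -> in_KinvZg K c' ->
  integrand c c' (upd x a (x a + 1)) y = integrand c c' x y.
Proof.
case: a => k p hc hc'; rewrite -[existT _ k p]/(cc p).
apply: (@integrand_factor _ _ _ _ _ _ (pi%:C * 'i * (d%:R - (K k k)%:R))).
- by rewrite cover_point_upd_fst (wave_shift_coord1 htau xi hWen).
- by rewrite cover_point_upd_fst (wave_shift_coord1 htau xi hWen).
- by rewrite Re_pi_i imCD imCN !Im_nat subrr !mulr0 !oppr0 mulr0 oppr0 expR0 mul1r.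
Qed.

Lemma integrand_periodic_snd c c' (a : coord) x y :
  integrand c c' x (upd y a (y a + 1)) = integrand c c' x y.
Proof.
case: a => k p; rewrite -[existT _ k p]/(cc p).
apply: (@integrand_factor _ _ _ _ _ _
  (pi%:C * 'i * (d%:R - (K k k)%:R - tau * d%:R)
        - 2 * pi%:C * 'i * (d%:R * cover_point x y (cc p) + xi k ord0))).
- by rewrite cover_point_upd_snd (wave_shift_coord_tau htau xi hWen).
- by rewrite cover_point_upd_snd (wave_shift_coord_tau htau xi hWen).
- rewrite weight_shift_coord; congr (expR (- (2 * _)) * _).
  rewrite reCD reCN Re_pi_i Re_2pi_i !(imCD, imCN, imCM, Im_nat, Re_nat, Im_real, Re_real).
  ring.
Qed.

Lemma frac1d_bounds : (0 : R) <= 1 / d%:R <= (1 : R).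
Proof.
have d1 := Wen_d_gt0 hWen; rewrite divr_ge0//=.
by rewrite ler_pdivrMr ?ltr0n// mul1r ler1n.
Qed.

Lemma box_uc_Re_integrand c c' :
  box_uc (uncurry_halves (fun x y => complex.Re (integrand c c' x y))).
Proof. by have [] := integrand_uc c c'. Qed.

Lemma box_uc_Im_integrand c c' :
  box_uc (uncurry_halves (fun x y => complex.Im (integrand c c' x y))).
Proof. by have [] := integrand_uc c c'. Qed.

(** The [+ 0] matches [double_integral_shift] with a zero translation in [y]. The weight does not
    see [x], so only the two phases remain, the second one conjugated. *)
Lemma integrand_translate1 c c' x y :
  integrand c c' (fun a => x a + 1 / d%:R) (fun a => y a + 0) =
  unit_exp (\sum_k c k ord0 - \sum_k c' k ord0) * integrand c c' x y.
Proof.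
have -> : (fun a => y a + 0) = y by apply/funext => a; rewrite addr0.
have e : cover_point (fun a => x a + 1 / d%:R) y = (fun a => cover_point x y a + 1 / d%:R).
  apply/funext => a; rewrite /cover_point rmorphD rmorphM fmorphV rmorph1 rmorph_nat; ring.
rewrite /integrand e !(wave_translate1 htau xi hWen).
move: (wave c _) (wave c' _) (weight _ _ _ _) => w w' v.
rewrite rmorphM mulrACA -[LHS]mulrA; congr (_ * _).
rewrite unit_expD; congr (_ * _).
exact: conj_unit_exp.
Qed.

(** The scalar product is built from two real integrals: each is translated separately, and
    multiplication by the phase is recovered from their linear combinations. *)
Lemma scalar_product_translate1 c c' : in_KinvZg K c -> in_KinvZg K c' ->
  scalar_product tau d xi (wave c) (wave c') =
  unit_exp (\sum_k c k ord0 - \sum_k c' k ord0) * scalar_product tau d xi (wave c) (wave c').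
Proof.
move=> hc hc'; set om := unit_exp _; rewrite scalar_productE.
have h01 := frac1d_bounds.
have uR := box_uc_Re_integrand c c'; have uI := box_uc_Im_integrand c c'.
have z01 : (0 : R) <= 0 <= (1 : R) by rewrite lexx ler01.
set DR := double_integral _; set DI := double_integral _.
have ER : DR = complex.Re om * DR - complex.Im om * DI.
  rewrite -[LHS](double_integral_shift h01 z01 uR); last 2 first.
    by move=> a x y; rewrite integrand_periodic_fst.
    by move=> a x y; rewrite integrand_periodic_snd.
  rewrite /DR /DI -mulNr -double_integral_lin//.
  congr double_integral; apply/funext => x; apply/funext => y.
  by rewrite integrand_translate1 reCM mulNr.
have EI : DI = complex.Re om * DI + complex.Im om * DR.
  rewrite -[LHS](double_integral_shift h01 z01 uI); last 2 first.
    by move=> a x y; rewrite integrand_periodic_fst.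
    by move=> a x y; rewrite integrand_periodic_snd.
  rewrite /DR /DI -double_integral_lin//.
  congr double_integral; apply/funext => x; apply/funext => y.
  by rewrite integrand_translate1 imCM.
by apply: complexP; rewrite ?reCM ?imCM; [exact: ER|exact: EI].
Qed.

Lemma scalar_product_orthogonal c c' : in_KinvZg K c -> in_KinvZg K c' ->
  unit_exp (\sum_k c k ord0 - \sum_k c' k ord0) != 1 ->
  scalar_product tau d xi (wave c) (wave c') = 0.
Proof.
move=> hc hc' om1; have := scalar_product_translate1 hc hc'.
move: (scalar_product _ _ _ _ _) => S SE; apply/eqP.
have /eqP : (1 - unit_exp (\sum_k c k ord0 - \sum_k c' k ord0)) * S = 0.
  by rewrite mulrBl mul1r -SE subrr.
by rewrite mulf_eq0 subr_eq0 eq_sym (negbTE om1).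
Qed.

Lemma integrand_translate_tau c x y :
  integrand c c (fun a => x a + 0) (fun a => y a + 1 / d%:R) =
  integrand (c + u) (c + u) x y.
Proof.
have -> : (fun a => x a + 0) = x by apply/funext => a; rewrite addr0.
have e : cover_point x (fun a => y a + 1 / d%:R) = (fun a => cover_point x y a + tau / d%:R).
  apply/funext => a; rewrite /cover_point rmorphD rmorphM fmorphV rmorph1 rmorph_nat; ring.
rewrite /integrand e !(wave_translate_tau htau xi hWen) weight_translate.
move: (wave _ _) (weight _ _ _ _) => w v.
rewrite rmorphM mulrACA expC_mul_conj rmorphM mulrACA -[RHS]mul1r; congr (_ * _).
rewrite -rmorphM -expRD; set e2 := (X in expR X); suff -> : e2 = 0 by rewrite expR0.
rewrite {}/e2.
rewrite reCD !reCN Re_pi_i Re_2pi_i imCM imCD !(Im_real, Re_real) !Im_sum.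
have -> : \sum_k complex.Im (\sum_p zc (cover_point x y) (k := k) p) = \sum_a t * y a.
  rewrite sum_coord; apply: eq_bigr => k _; rewrite Im_sum; apply: eq_bigr => p _.
  by rewrite /zc /cover_point imCD imCM !(Im_real, Re_real); ring.
have -> : \sum_k complex.Im (((n k ord0)%:R / d%:R)%:C * xi k ord0) =
    \sum_k (n k ord0)%:R / d%:R * complex.Im (xi k 0).
  by apply: eq_bigr => k _; rewrite imCM !(Im_real, Re_real) mul0r addr0.
ring.
Qed.

(** Stating [c'] through an equation lets an induction on multiples of [u] apply it to (l + 1) u
    directly. *)
Lemma scalar_product_translate_tau c c' : in_KinvZg K c -> c' = c + u ->
  scalar_product tau d xi (wave c') (wave c') =
  scalar_product tau d xi (wave c) (wave c).
Proof.
move=> hc ->; rewrite [LHS]scalar_productE [RHS]scalar_productE.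
have h01 := frac1d_bounds.
have z01 : (0 : R) <= 0 <= (1 : R) by rewrite lexx ler01.
apply: complexP => /=.
- rewrite -[RHS](double_integral_shift z01 h01 (box_uc_Re_integrand c c)) /=; last 2 first.
    by move=> a x y; rewrite integrand_periodic_fst.
    by move=> a x y; rewrite integrand_periodic_snd.
  congr double_integral; apply/funext => x; apply/funext => y.
  by rewrite integrand_translate_tau.
- rewrite -[RHS](double_integral_shift z01 h01 (box_uc_Im_integrand c c)) /=; last 2 first.
    by move=> a x y; rewrite integrand_periodic_fst.
    by move=> a x y; rewrite integrand_periodic_snd.
  congr double_integral; apply/funext => x; apply/funext => y.
  by rewrite integrand_translate_tau.
Qed.

Lemma in_ZgB c c' : in_Zg c -> in_Zg c' -> in_Zg (c - c').
Proof.
move=> [m ->] [m' ->]; exists (m - m').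
by apply/matrixP => i j; rewrite !mxE intrB.
Qed.

Lemma in_Zg_sum c : in_Zg c -> exists m : int, \sum_k c k ord0 = m%:~R.
Proof.
move=> [m ->]; exists (\sum_k m k ord0); rewrite rmorph_sum.
by apply: eq_bigr => k _; rewrite mxE.
Qed.

Lemma wave_congr c c' : in_Zg (c - c') -> wave c = wave c'.
Proof.
move=> [m e]; apply/funext => z.
by rewrite -(wave_translate_int htau xi hWen c' m) -e addrC subrK.
Qed.

Lemma multiple_in_KinvZg (j : nat) : in_KinvZg K (j%:R *: u).
Proof.
exists (const_mx j%:Z).
have -> : map_mx intr (const_mx j%:Z) = j%:R *: const_mx 1 :> 'cV[R]_g.
  by apply/matrixP => k l; rewrite !mxE mulr1.
rewrite -(Kreal_frac_n hWen) -scalemxAr mulmxA mulVmx ?mul1mx//.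
exact: Kreal_unit hWen.
Qed.

Hypothesis hprim : primary K n d.

(* The coordinates of [j *: u] sum to [j * rho / delta]. *)
Lemma multiple_sum_inj (i j : 'I_(delta K)) (m : int) :
  \sum_k (i%:R *: u) k ord0 - \sum_k (j%:R *: u) k ord0 = m%:~R -> i = j.
Proof.
have d0 : d%:R != 0 :> R by rewrite pnatr_eq0 -lt0n (Wen_d_gt0 hWen).
have su (l : nat) : \sum_k (l%:R *: u) k ord0 = (l * \sum_k n k ord0)%N%:R / d%:R.
  rewrite natrM natr_sum -mulrA mulr_suml mulr_sumr.
  by apply: eq_bigr => k _; rewrite !mxE.
rewrite !su -mulrBl => /(congr1 (fun x : R => x * d%:R)); rewrite divfK// => E.
have EZ : ((i * \sum_k n k ord0)%N%:Z - (j * \sum_k n k ord0)%N%:Z = m * d%:Z)%R.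
  by apply: (@intr_inj R); rewrite intrB intrM -!pmulrn E.
have rE := rhoE hWen.
have dZ : d%:Z != 0 by rewrite eqz_nat -lt0n (Wen_d_gt0 hWen).
have E2 : (i%:Z - j%:Z) * (rho K n d)%:Z = m * (delta K)%:Z.
  apply: (mulIf dZ); rewrite -mulrA -PoszM rE PoszM -[RHS]mulrAC -EZ !PoszM; ring.
have cp : coprime (delta K) (rho K n d) by apply/eqP.
have dv : (delta K %| absz (i%:Z - j%:Z)%R)%N.
  by rewrite -(Gauss_dvdl _ cp) -[rho K n d]/(absz (rho K n d)%:Z) -abszM E2 abszM dvdn_mull.
have [hi hj] := (ltn_ord i, ltn_ord j).
have small : (absz (i%:Z - j%:Z)%R < delta K)%N by lia.
apply/val_inj => /=; have [ne|] := posnP (absz (i%:Z - j%:Z)%R); first by lia.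
by move=> /dvdn_leq /(_ dv); rewrite leqNgt small.
Qed.

(** A pigeonhole argument: congruent multiples have coordinate sums differing by an integer, so by
    [multiple_sum_inj] sending j to the index of the class of j u is an injective self-map of a
    finite type, hence onto. *)
Lemma enumerates_multiple (c : 'I_(delta K) -> 'cV[R]_g) : enumerates_Pi K c ->
  forall i, exists j : 'I_(delta K), in_Zg (j%:R *: u - c i).
Proof.
move=> [hc inj surj].
have /choice[f hf] : forall j : 'I_(delta K), exists i, in_Zg (j%:R *: u - c i).
  by move=> j; apply: surj; exact: multiple_in_KinvZg.
have finj : injective f.
  move=> j j' ff; have hj := hf j; have hj' := hf j'; rewrite ff in hj.
  have := in_ZgB hj hj'; rewrite opprB addrA subrK => /in_Zg_sum [m hm].
  apply: (@multiple_sum_inj j j' m); rewrite -hm -sumrB.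
  by apply: eq_bigr => k _; rewrite !mxE.
by move=> i; exists (invF finj i); have := hf (invF finj i); rewrite f_invF.
Qed.

Lemma Gram_scalar (c : 'I_(delta K) -> 'cV[R]_g) : enumerates_Pi K c ->
  Gram tau d xi (fun i => wave (c i)) =
  (scalar_product tau d xi (wave 0) (wave 0))%:M.
Proof.
move=> ec; have [hc inj _] := ec; have mult := enumerates_multiple ec.
apply/matrixP => i i'; rewrite !mxE; have [<-|ii'] := eqVneq i i'.
  have [j hj] := mult i; rewrite -(wave_congr hj) mulr1n.
  (* Descent from j u to 0 by steps of [u], each preserving the norm. *)
  elim: (nat_of_ord j) => [|l IH].
    by have -> : 0%:R *: u = 0 by rewrite mulr0n scale0r.
  apply: etrans IH; apply: scalar_product_translate_tau; first exact: multiple_in_KinvZg.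
  by rewrite -natr1 scalerDl scale1r.
apply: (scalar_product_orthogonal (hc i) (hc i')); apply/eqP => om1.
have [m hm] := unit_exp_eq1 om1.
have [j hj] := mult i; have [j' hj'] := mult i'.
have [m1 hm1] := in_Zg_sum hj; have [m2 hm2] := in_Zg_sum hj'.
have jj' : j = j'.
  (* [m] is the difference of the coordinate sums of c_i and c_i'; [m1] and [m2] correct for the
     passage to the representatives j u and j' u. *)
  apply: (@multiple_sum_inj _ _ (m1 - m2 + m)).
  rewrite rmorphD rmorphB /= -hm1 -hm2 -hm.
  have sB (a b : 'cV[R]_g) : \sum_k (a - b) k ord0 = \sum_k a k ord0 - \sum_k b k ord0.
    by rewrite -sumrB; apply: eq_bigr => k _; rewrite !mxE.
  by rewrite !sB; ring.
have : in_Zg (c i - c i').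
  by have := in_ZgB hj' hj; rewrite jj' opprB addrC addrA subrK.
by move=> /inj e; rewrite e eqxx in ii'.
Qed.

End GramMatrix.

Theorem theorem5p14 (R : realType) (tau : R[i]) (htau : 0 < complex.Im tau)
    (g : nat) (hg : (0 < g)%N)
    (K : 'M[nat]_g) (n : 'cV[nat]_g) (d : nat)
    (hWen : Wen_datum R K n d) (hprim : primary K n d)
    (xi : 'cV[R[i]]_g) :
  exists C0 : R[i],
    forall c : 'I_(delta K) -> 'cV[R]_g, enumerates_Pi K c ->
      Gram tau d xi (fun i => @wave R tau g K n xi (c i)) = C0%:M.
Proof.
(* The squared norm of the wave of the zero class, which is independent of any enumeration. *)
exists (scalar_product tau d xi (@wave R tau g K n xi 0) (@wave R tau g K n xi 0)).
by move=> c; exact: Gram_scalar.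
Qed.
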